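(* Let $k$ be an algebraically closed field, $\Lambda$ a Nakayama algebra (finite-dimensional over $k$) and $\mathcal{E}$ a subcategory of $\mathsf{mod}\,\Lambda$. Then $\mathcal{E}$ is left Schur if and only if $\mathcal{E}$ is closed under extensions, kernels and images. In particular, there is a bijection between the following two sets: (1) the set of monobricks in $\mathsf{mod}\,\Lambda$; (2) the set of subcategories of $\mathsf{mod}\,\Lambda$ closed under extensions, kernels and images. The maps are given by $\mathsf{Filt}$ (from (1) to (2)) and $\mathsf{sim}$ (from (2) to (1)).
   Context: $\mathsf{mod}\,\Lambda$ is the category of finitely generated right $\Lambda$-modules. All subcategories are full and closed under isomorphisms, and (extension-closed) subcategories are understood to contain the zero object. A subcategory is closed under kernels (resp. images) if for every morphism in it, the kernel (resp. image) taken in $\mathsf{mod}\,\Lambda$ belongs to it. A brick is a module whose endomorphism ring is a division ring. A monobrick is a set $\mathcal{M}$ of isomorphism classes of bricks such that every morphism between elements of $\mathcal{M}$ is either zero or injective. For an extension-closed subcategory $\mathcal{E}$ of $\mathsf{mod}\,\Lambda$, a non-zero object $M \in \mathcal{E}$ is simple in $\mathcal{E}$ if there is no exact sequence $0 \to L \to M \to N \to 0$ in $\mathsf{mod}\,\Lambda$ with $L, M, N \in \mathcal{E}$ and $L, N \neq 0$; $\mathsf{sim}\,\mathcal{E}$ is the set of isomorphism classes of simple objects in $\mathcal{E}$. A subcategory $\mathcal{E}$ is left Schur if it is closed under extensions and, for every simple object $M$ in $\mathcal{E}$, every morphism $M \to X$ with $X \in \mathcal{E}$ is either zero or injective. For a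 collection $\mathcal{C}$ of modules, $\mathsf{Filt}\,\mathcal{C}$ is the subcategory of all modules $X$ admitting a chain of submodules $0 = X_0 < X_1 < \cdots < X_n = X$ ($n \ge 0$) with each $X_i/X_{i-1}$ in $\mathcal{C}$ (up to isomorphism). *)

(* Defs.v *)
From HB Require Import structures.
From mathcomp Require Import all_boot all_algebra all_field.
From mathcomp Require Import boolp classical_sets functions.

Set Implicit Arguments.
Unset Strict Implicit.
Unset Printing Implicit Defensive.

Import GRing.Theory.
Local Open Scope classical_set_scope.
Local Open Scope ring_scope.

Section Modules.
Variable R : nzRingType.

Definition onto (A B : Type) (f : A -> B) : Prop := forall y, exists x, f x = y.

Definition is_zero (M : lmodType R) : Prop := forall x : M, x = 0.

Definition is_iso (M N : lmodType R) : Prop :=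
  exists f : {linear M -> N}, bijective f.

Definition zero_or_injective (M N : lmodType R) (f : {linear M -> N}) : Prop :=
  (forall x, f x = 0) \/ injective f.

Definition short_exact (L M N : lmodType R)
    (f : {linear L -> M}) (g : {linear M -> N}) : Prop :=
  [/\ injective f, onto g & range f = [set x | g x = 0]].

Definition finitely_generated (M : lmodType R) : Prop :=
  exists (n : nat) (e : 'I_n -> M),
    forall x, exists c : 'I_n -> R, x = \sum_(i < n) c i *: e i.

Definition uniserial (M : lmodType R) : Prop :=
  forall U V : {pred M}, GRing.submod_closed U -> GRing.submod_closed V ->
    {subset U <= V} \/ {subset V <= U}.

Definition indecomposable (M : lmodType R) : Prop :=
  ~ is_zero M /\
  forall U V : {pred M}, GRing.submod_closed U -> GRing.submod_closed V ->
    (forall x, x \in U -> x \in V -> x = 0) ->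
    (forall x, exists u v, [/\ u \in U, v \in V & x = u + v]) ->
    (forall x, x \in U -> x = 0) \/ (forall x, x \in V -> x = 0).

Definition projective (P : lmodType R) : Prop :=
  forall (M N : lmodType R) (g : {linear M -> N}) (h : {linear P -> N}),
    onto g -> exists h' : {linear P -> M}, forall x, g (h' x) = h x.

Record fgMod := FGMod {
  fgMod_sort :> lmodType R;
  fgModP : finitely_generated fgMod_sort
}.

Definition serial_ring : Prop :=
  forall P : fgMod, projective P -> indecomposable P -> uniserial P.

(* Subcategories (full, closed under isomorphisms) and sets of isomorphism
   classes of modules are both represented by iso-closed predicates on modules.
   (fgMod lives in a universe too large for classical_sets.set.) *)
Definition iso_closed (E : fgMod -> Prop) : Prop :=
  forall M N : fgMod, is_iso M N -> E M -> E N.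

(* Extension-closed subcategories contain the zero object by convention. *)
Definition ext_closed (E : fgMod -> Prop) : Prop :=
  (forall Z : fgMod, is_zero Z -> E Z) /\
  forall (L M N : fgMod) (f : {linear L -> M}) (g : {linear M -> N}),
    short_exact f g -> E L -> E N -> E M.

(* A kernel or an image of a map is any module embedded with the right range;
   for iso-closed E the choice of representative is irrelevant. *)
Definition ker_closed (E : fgMod -> Prop) : Prop :=
  forall (X Y : fgMod) (f : {linear X -> Y}), E X -> E Y ->
  forall (K : fgMod) (i : {linear K -> X}),
    injective i -> range i = [set x | f x = 0] -> E K.

Definition im_closed (E : fgMod -> Prop) : Prop :=
  forall (X Y : fgMod) (f : {linear X -> Y}), E X -> E Y ->
  forall (I : fgMod) (i : {linear I -> Y}),
    injective i -> range i = range f -> E I.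

Definition ext_ker_im_closed (E : fgMod -> Prop) : Prop :=
  [/\ ext_closed E, ker_closed E & im_closed E].

Definition brick (M : lmodType R) : Prop :=
  ~ is_zero M /\
  forall f : {linear M -> M}, ~ (forall x, f x = 0) ->
    exists g : {linear M -> M}, cancel f g /\ cancel g f.

Definition monobrick (C : fgMod -> Prop) : Prop :=
  [/\ iso_closed C,
      forall M, C M -> brick M &
      forall (M N : fgMod) (f : {linear M -> N}),
        C M -> C N -> zero_or_injective f].

Definition sim (E : fgMod -> Prop) : fgMod -> Prop := fun M =>
  [/\ E M, ~ is_zero M &
      ~ exists (L N : fgMod) (f : {linear L -> M}) (g : {linear M -> N}),
          [/\ short_exact f g, E L, E N, ~ is_zero L & ~ is_zero N]].

Definition left_schur (E : fgMod -> Prop) : Prop :=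
  ext_closed E /\
  forall (M X : fgMod) (f : {linear M -> X}),
    sim E M -> E X -> zero_or_injective f.

(* V / U is isomorphic to C: S is the submodule V viewed as a module, and p
   induces the isomorphism. *)
Definition subfactor_iso (M : lmodType R) (U V : {pred M}) (C : lmodType R) :
    Prop :=
  exists (S : lmodType R) (j : {linear S -> M}) (p : {linear S -> C}),
    [/\ injective j, range j = [set x | x \in V], onto p &
        forall s, p s = 0 <-> j s \in U].

Definition Filt (C : fgMod -> Prop) : fgMod -> Prop := fun M =>
  exists (n : nat) (X : nat -> {pred M}),
    [/\ forall i, (i <= n)%N -> GRing.submod_closed (X i),
        X 0%N =i pred1 0,
        X n =i predT &
        forall i, (i < n)%N ->
          [/\ {subset X i <= X i.+1},
              exists x, x \in X i.+1 /\ x \notin X i &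
              exists2 N : fgMod, C N & subfactor_iso (X i) (X i.+1) N]].

End Modules.

(* Right modules over A are left modules over the converse ring A^c. *)
Notation modr A := (fgMod A^c).

Definition nakayama (k : fieldType) (A : falgType k) : Prop :=
  serial_ring A /\ serial_ring A^c.

(* Main.v *)
(* If [E] is closed under kernels and images, then for [M] simple in [E] and
   [f : M -> X] the sequence [0 -> ker f -> M -> im f -> 0] lies in [E], so [f] is
   zero or injective.  Over any finite-dimensional algebra, [Filt] and [sim] are
   mutually inverse between monobricks and left Schur subcategories, by induction
   on dimension.  It remains to see that [Filt C] is closed under kernels and images
   for a monobrick [C] over a Nakayama algebra.

   The Nakayama hypothesis enters through a decomposition of 1 into primitive
   idempotents: for such an [e], any two elements of [R e] (resp. [e R]) are
   comparable for right (resp. left) divisibility.  This forces every brick to be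
   generated by a single [x = e x], and makes the annihilators in [R e] of two
   elements fixed by [e] comparable, so that one of the modules they generate maps
   onto the other.  This replaces projective covers in the induction on
   filtrations.

   Right [A]-modules are left modules over [R = A^c]. *)

From HB Require Import structures.
Require Import Defs.
From mathcomp Require Import all_boot all_algebra all_field.
From mathcomp Require Import boolp classical_sets functions.

Set Implicit Arguments.
Unset Strict Implicit.
Unset Printing Implicit Defensive.

Import GRing.Theory.
Local Open Scope classical_set_scope.
Local Open Scope ring_scope.

(** * Submodules *)

Section Submodules.
Variable R : nzRingType.
Implicit Types M N X Y : lmodType R.

(** A [Prop]-valued counterpart of [submod_closed], so that ranges, kernels and images are handled
    without boolean predicates. *)
Definition is_submod M (P : set M) : Prop :=
  P 0 /\ forall a x y, P x -> P y -> P (a *: x + y).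

Lemma is_submod0 M (P : set M) : is_submod P -> P 0.
Proof. by case. Qed.

Lemma is_submodD M (P : set M) x y : is_submod P -> P x -> P y -> P (x + y).
Proof. by move=> [_ lP] Px Py; rewrite -[x]scale1r; apply: lP. Qed.

Lemma is_submodZ M (P : set M) a x : is_submod P -> P x -> P (a *: x).
Proof. by move=> [P0 lP] Px; rewrite -[_ *: _]addr0; apply: lP. Qed.

Lemma is_submodB M (P : set M) x y : is_submod P -> P x -> P y -> P (x - y).
Proof.
move=> sP Px Py; rewrite -[- y]scaleN1r.
by apply: is_submodD => //; apply: is_submodZ.
Qed.

Lemma is_submodT M : is_submod (@setT M).
Proof. by []. Qed.

Lemma is_submod_zero M : is_submod [set (0 : M)].
Proof. by split=> // a x y -> ->; rewrite scaler0 addr0. Qed.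

Lemma is_submodP M (P : {pred M}) :
  is_submod [set x | x \in P] <-> submod_closed P.
Proof. by split; move=> [P0 lP]; split=> // a x y; apply: lP. Qed.

Lemma is_submod_preim M N (f : {linear M -> N}) (P : set N) :
  is_submod P -> is_submod [set x | P (f x)].
Proof.
move=> [P0 lP]; split=> [|a x y] /=; first by rewrite linear0.
by rewrite linearP; apply: lP.
Qed.

Lemma is_submod_ker M N (f : {linear M -> N}) : is_submod [set x | f x = 0].
Proof.
by split=> [|a x y] /=; rewrite ?linear0 // linearP => -> ->; rewrite scaler0 addr0.
Qed.

Lemma is_submod_image M N (f : {linear M -> N}) (P : set M) :
  is_submod P -> is_submod [set f x | x in P].
Proof.
move=> [P0 lP]; split=> [|a _ _ [x Px <-] [y Py <-]].
  by exists 0 => //; rewrite linear0.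
by exists (a *: x + y); [apply: lP | rewrite linearP].
Qed.

Lemma is_submod_range M N (f : {linear M -> N}) : is_submod (range f).
Proof. exact: is_submod_image. Qed.

Definition cyc M (x : M) : set M := [set y | exists a, y = a *: x].

Lemma cyc_submod M (x : M) : is_submod (cyc x).
Proof.
split=> [|a _ _ [b ->] [c ->]]; first by exists 0; rewrite scale0r.
by exists (a * b + c); rewrite scalerA scalerDl.
Qed.

Lemma cyc_id M (x : M) : cyc x x.
Proof. by exists 1; rewrite scale1r. Qed.

Lemma cyc_min M (P : set M) x : is_submod P -> P x -> cyc x `<=` P.
Proof. by move=> sP Px _ [a ->]; apply: is_submodZ. Qed.

Definition addmod M (U V : set M) : set M :=
  [set x | exists u v, [/\ U u, V v & x = u + v]].

Lemma addmod_submod M (U V : set M) :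
  is_submod U -> is_submod V -> is_submod (addmod U V).
Proof.
move=> [U0 lU] [V0 lV]; split=> [|a _ _ [u [v [Uu Vv ->]]] [w [t [Uw Vt ->]]]].
  by exists 0, 0; rewrite addr0.
exists (a *: u + w), (a *: v + t); split; [exact: lU|exact: lV|].
by rewrite scalerDr addrACA.
Qed.

Definition subm_pred M (P : set M) : {pred M} := fun x => `[<P x>].

Record subm M (P : set M) (sP : is_submod P) :=
  Subm { subm_val : M; _ : subm_pred P subm_val }.

Section SubType.
Variables (M : lmodType R) (P : set M) (sP : is_submod P).

HB.instance Definition _ := [isSub of subm sP for (@subm_val _ _ sP)].
HB.instance Definition _ := [Choice of subm sP by <:].

Fact subm_closed : submod_closed (subm_pred P).
Proof.
split; first by apply/asboolP; exact: is_submod0.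
by move=> a x y /asboolP Px /asboolP Py; apply/asboolP; apply: sP.2.
Qed.

HB.instance Definition _ :=
  GRing.SubChoice_isSubLmodule.Build R M (subm_pred P) (subm sP) subm_closed.

Definition submod_incl : {linear subm sP -> M} := val.

Lemma submod_incl_inj : injective submod_incl.
Proof. exact: val_inj. Qed.

Lemma submod_inclP (x : subm sP) : P (submod_incl x).
Proof. by apply/asboolP; exact: (valP x). Qed.

Lemma submod_lift x : P x -> exists y : subm sP, submod_incl y = x.
Proof. by move=> /asboolP Px; exists (Subm sP Px). Qed.

Lemma range_submod_incl : range submod_incl = P.
Proof.
apply/seteqP; split=> [_ [x _ <-]|x /submod_lift[y <-]]; last by exists y.
exact: submod_inclP.
Qed.

End SubType.
End Submodules.
Arguments submod_incl {R M P sP}.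

(** * Linear maps and dimension *)

Section LinearMaps.
Variable R : nzRingType.

(** Linearity with coefficient [-1], applied to two values at the same point, yields a value at [0],
    which vanishes; so [r] is single-valued. Maps out of cyclic modules, taking [a *: x] to
    [a *: y], arise in this way. *)
Lemma lin_of_rel (X Y : lmodType R) (r : X -> Y -> Prop) :
  (forall x, exists y, r x y) -> (forall y, r 0 y -> y = 0) ->
  (forall a x x' y y', r x y -> r x' y' -> r (a *: x + x') (a *: y + y')) ->
  exists f : {linear X -> Y}, forall x y, r x y <-> f x = y.
Proof.
move=> tot r0 lin.
have r00 : r 0 0 by have [y ry] := tot 0; rewrite -[X in r _ X](r0 _ ry).
have fun_r x y y' : r x y -> r x y' -> y = y'.
  move=> /(lin (-1)) H /H; rewrite !scaleN1r addNr => /r0 /eqP.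
  by rewrite addrC subr_eq0 => /eqP.
have [f fP] := choice tot.
have f_lin : linear f.
  by move=> a x y; apply: (fun_r (a *: x + y)); [exact: fP|apply: lin].
pose L := GRing.isLinear.Build R X Y _ f f_lin.
pose F : {linear X -> Y} := HB.pack f L.
exists F => x y; split=> [rxy|<-]; last exact: fP.
exact: fun_r (fP x) rxy.
Qed.

Lemma lin_inj (X Y : lmodType R) (f : {linear X -> Y}) :
  (forall x, f x = 0 -> x = 0) -> injective f.
Proof.
move=> f0 x y /eqP; rewrite -subr_eq0 -linearB => /eqP /f0 /eqP.
by rewrite subr_eq0 => /eqP.
Qed.

Lemma lin_factor_inj (X Y Z : lmodType R) (f : {linear X -> Y})
    (i : {linear Z -> Y}) :
  injective i -> range f `<=` range i ->
  exists h : {linear X -> Z}, forall x, i (h x) = f x.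
Proof.
move=> i_inj sub.
have [|y|a x x' y y' e e'|h hP] := @lin_of_rel X Z (fun x z => i z = f x).
- move=> x; have [|z _ e] := sub (f x); last by exists z.
  by exists x.
- by rewrite linear0 -(linear0 i) => /i_inj.
- by rewrite !linearP e e'.
- by exists h => x; apply/hP.
Qed.

Lemma onto_inj_bij (X Y : Type) (f : X -> Y) :
  injective f -> onto f -> bijective f.
Proof.
move=> f_inj /choice[g gK]; exists g => // x; apply: f_inj; exact: gK.
Qed.

Lemma bij_onto (X Y : Type) (f : X -> Y) : bijective f -> onto f.
Proof. by case=> g _ gK y; exists (g y). Qed.

Lemma bij_linear_inv (X Y : lmodType R) (f : {linear X -> Y}) :
  bijective f -> exists2 g : {linear Y -> X}, cancel f g & cancel g f.
Proof.
move=> [g fK gK]; have f_inj := can_inj fK.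
have [|h hP] := @lin_factor_inj Y Y X idfun f f_inj.
  by move=> y _; exists (g y).
by exists h => // x; apply: f_inj; rewrite hP.
Qed.

Lemma is_iso_sym (X Y : lmodType R) : is_iso X Y -> is_iso Y X.
Proof. by move=> [f /bij_linear_inv[g fK gK]]; exists g, f. Qed.

Lemma cyc_fg (X : lmodType R) (x : X) : finitely_generated (subm (cyc_submod x)).
Proof.
have [u ux] := @submod_lift _ _ _ (cyc_submod x) _ (cyc_id x).
exists 1%N, (fun=> u) => v.
have [a av] := submod_inclP v.
exists (fun=> a); rewrite big_ord1; apply: submod_incl_inj.
by rewrite linearZZ ux.
Qed.

(** These are the properties of dimension over a field that the later arguments use; filtrations and
    idempotents are thus treated without mentioning the ground field. *)
Definition is_dimension (d : fgMod R -> nat) : Prop :=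
  [/\ forall (M : fgMod R) (P : set M) (sP : is_submod P),
        finitely_generated (subm sP),
      forall (L M : fgMod R) (f : {linear L -> M}),
        injective f -> ~ onto f -> (d L < d M)%N,
      forall (M N : fgMod R) (f : {linear M -> N}), onto f -> (d N <= d M)%N &
      forall (M N : fgMod R) (f : {linear M -> N}),
        onto f -> ~ injective f -> (d N < d M)%N].

End LinearMaps.

(** Take a subspace of maximal dimension inside [P]; adjoining a vector of [P] stays inside [P],
    hence does not enlarge it. *)
Lemma vspace_of_pred (K : fieldType) (vT : vectType K) (P : vT -> Prop) :
  P 0 -> (forall a u v, P u -> P v -> P (a *: u + v)) ->
  exists V : {vspace vT}, forall v, P v <-> v \in V.
Proof.
move=> P0 Plin.
pose Q n := `[<exists2 V : {vspace vT}, \dim V = n & forall v, v \in V -> P v>].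
have exQ : exists n, Q n.
  exists 0%N; apply/asboolP; exists 0%VS; first by rewrite dimv0.
  by move=> v; rewrite memv0 => /eqP ->.
have ubQ n : Q n -> (n <= \dim {:vT})%N.
  by move=> /asboolP[V <- _]; rewrite dimvS ?subvf.
have [n /asboolP[V dimV VP] maxV] := ex_maxnP exQ ubQ.
exists V => v; split=> [Pv|]; last exact: VP.
have : Q (\dim (V + <[v]>)).
  apply/asboolP; exists (V + <[v]>)%VS => // w /memv_addP[u uV [t /vlineP[a ->] ->]].
  by rewrite addrC; apply: Plin => //; apply: VP.
move=> /maxV; rewrite -dimV => le_dim.
have : (V == V + <[v]>)%VS by rewrite eqEdim addvSl.
move=> /eqP ->; apply: (subvP (addvSr _ _)); exact: memv_line.
Qed.

(** * Dimension of modules over a ring that receives a field *)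

Section FiniteDimension.
Variables (R : nzRingType) (k : fieldType) (iota : {rmorphism k -> R}).

(** Coordinates stand in for a vector space structure on [M], so that linear algebra takes place in
    ['rV[k]_n]. *)
Definition kspan (M : lmodType R) n (b : 'I_n -> M) (c : 'rV[k]_n) : M :=
  \sum_i iota (c 0 i) *: b i.

Lemma kspan_lin (M : lmodType R) n (b : 'I_n -> M) a c c' :
  kspan b (a *: c + c') = iota a *: kspan b c + kspan b c'.
Proof.
rewrite scaler_sumr -big_split /=; apply: eq_bigr => i _.
by rewrite !mxE rmorphD rmorphM /= scalerDl scalerA.
Qed.

Lemma kspan0 (M : lmodType R) n (b : 'I_n -> M) : kspan b 0 = 0.
Proof. by apply: big1 => i _; rewrite mxE rmorph0 scale0r. Qed.

Lemma kspan_sum (M : lmodType R) n (b : 'I_n -> M) m (c : 'rV[k]_m)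
    (v : 'I_m -> 'rV[k]_n) :
  kspan b (\sum_i c 0 i *: v i) = kspan (fun i => kspan b (v i)) c.
Proof.
rewrite [RHS]/kspan.
apply: (big_rec2 (fun x y => kspan b x = y)) => [|i x y _ <-].
  exact: kspan0.
exact: kspan_lin.
Qed.

(** This expresses dimension at most [n], as the family [b] may be dependent. *)
Definition kspans (M : lmodType R) n : Prop :=
  exists b : 'I_n -> M, forall x, exists c, x = kspan b c.

Lemma kspans_onto (M N : lmodType R) (f : {linear M -> N}) n :
  onto f -> kspans M n -> kspans N n.
Proof.
move=> f_onto [b bP]; exists (f \o b) => y.
have [x <-] := f_onto y; have [c ->] := bP x; exists c.
by rewrite linear_sum; apply: eq_bigr => i _; rewrite linearZ.
Qed.

Lemma kspans_fin (M : lmodType R) (I : finType) (b : I -> M) :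
  (forall x, exists c : I -> k, x = \sum_i iota (c i) *: b i) ->
  kspans M #|I|.
Proof.
move=> bP; exists (b \o enum_val) => x; have [c ->] := bP x.
exists (\row_i c (enum_val i)).
rewrite /kspan (reindex (enum_val : 'I_#|I| -> I)) /=; last first.
  by apply: onW_bij; apply: enum_val_bij.
by apply: eq_bigr => i _; rewrite mxE.
Qed.

Lemma coord_vspace (n : nat) (V : {vspace 'rV[k]_n}) v : v \in V ->
  exists c : 'rV[k]_(\dim V), v = \sum_i c 0 i *: (vbasis V)`_i.
Proof.
move=> /coord_vbasis vE; exists (\row_i coord (vbasis V) i v).
by rewrite {1}vE; apply: eq_bigr => i _; rewrite mxE.
Qed.

(** Let [V] be the preimage of [P] in ['rV[k]_n] and [m] its dimension. A basis of [V] spans [P],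
    and a basis of a complement of [V] spans every quotient that kills [P]. *)
Lemma kspans_submod (M : lmodType R) n (P : set M) (sP : is_submod P) :
  kspans M n ->
  exists m, [/\ (m <= n)%N, kspans (subm sP) m,
    (exists x, ~ P x) -> (m < n)%N,
    (exists2 x, P x & x <> 0) -> (0 < m)%N &
    forall (N : lmodType R) (f : {linear M -> N}), onto f ->
      (forall x, P x -> f x = 0) -> kspans N (n - m)%N].
Proof.
move=> [b bP].
have [|a u v Pu Pv|V VP] := @vspace_of_pred k 'rV[k]_n (fun v => P (kspan b v)).
- by rewrite kspan0; apply: is_submod0.
- by rewrite kspan_lin; apply: sP.2.
have dimT : \dim {:'rV[k]_n} = n by rewrite dimvf /dim /= mul1n.
have le_dim : (\dim V <= n)%N.
  by have := dimvS (subvf V); rewrite dimT.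
exists (\dim V); split=> //.
- have : forall i : 'I_(\dim V),
      exists y : subm sP, submod_incl y = kspan b (vbasis V)`_i.
    move=> i; apply: submod_lift; apply/VP; apply: vbasis_mem.
    by rewrite mem_nth ?size_tuple.
  move=> /choice[e eP]; exists e => y.
  have [v yv] := bP (submod_incl y).
  have /coord_vspace[c vc] : v \in V.
    by apply/VP; rewrite -yv; apply: submod_inclP.
  exists c; apply: submod_incl_inj; rewrite yv vc kspan_sum linear_sum.
  by apply: eq_bigr => i _; rewrite linearZZ eP.
- move=> [x nPx]; have [v xv] := bP x.
  rewrite ltn_neqAle le_dim andbT.
  apply/eqP => dimV; apply: nPx; rewrite xv; apply/VP.
  have : (V == fullv)%VS by rewrite eqEdim subvf dimT dimV leqnn.
  by move=> /eqP ->; rewrite memvf.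
- move=> [x Px x0]; have [v xv] := bP x.
  rewrite lt0n dimv_eq0; apply/eqP => V0; apply: x0.
  have : v \in V by apply/VP; rewrite -xv.
  by rewrite V0 memv0 xv => /eqP ->; rewrite kspan0.
- move=> N f f_onto fP.
  have -> : (n - \dim V)%N = \dim (V^C) by rewrite dimv_compl dimT.
  exists (fun i => f (kspan b (vbasis V^C)`_i)) => z.
  have [x <-] := f_onto z; have [v ->] := bP x.
  have : v \in (V + V^C)%VS by rewrite addv_complf memvf.
  move=> /memv_addP[u uV [w /coord_vspace[c wc] ->]].
  exists c; rewrite -[u]scale1r kspan_lin linearD linearZ /=.
  rewrite (fP (kspan b u)) ?scaler0 ?add0r; last by apply/VP.
  rewrite wc kspan_sum linear_sum.
  by apply: eq_bigr => i _; rewrite linearZ.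
Qed.

Lemma kspans_fg (M : lmodType R) n : kspans M n -> finitely_generated M.
Proof.
move=> [b bP]; exists n, b => x; have [c ->] := bP x.
by exists (fun i => iota (c 0 i)).
Qed.

Lemma fg_kspans (M : lmodType R) n :
  kspans R^o n -> finitely_generated M -> exists m, kspans M m.
Proof.
move=> [r rP] [m [e eP]]; exists #|{: 'I_m * 'I_n}|.
apply: (@kspans_fin M _ (fun ij => r ij.2 *: e ij.1)) => x.
have [a ->] := eP x; have /choice[c cP] := fun i => rP (a i).
exists (fun ij => c ij.1 0 ij.2).
rewrite -(pair_bigA _ (fun i j => iota (c i 0 j) *: (r j *: e i))) /=.
apply: eq_bigr => i _; rewrite {1}cP /kspan scaler_suml.
by apply: eq_bigr => j _; rewrite scalerA.
Qed.

(** [d M] is the least [n] with [kspans M n]. Strict decrease comes from [kspans_submod], applied to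
    the range of an injective map and to the kernel of a surjective one. *)
Lemma finite_dimension_exists n : kspans R^o n ->
  exists d : fgMod R -> nat, is_dimension d.
Proof.
move=> spanR.
have : forall M : fgMod R, exists m, kspans M m /\
    forall m', kspans M m' -> (m <= m')%N.
  move=> M; have [m0 m0P] := fg_kspans spanR (fgModP M).
  have exm : exists m, `[<kspans M m>] by exists m0; apply/asboolP.
  have [m /asboolP mP minm] := ex_minnP exm.
  by exists m; split=> // m' /asboolP /minm.
move=> /choice[d dP]; exists d; split.
- move=> M P sP; have [/(kspans_submod sP)[m [_ + _ _ _]] _] := dP M.
  exact: kspans_fg.
- move=> L M f f_inj f_nonto.
  have [/(kspans_submod (is_submod_range f))[m [_ spm ltm _ _]] _] := dP M.
  have [|h hP] := @lin_factor_inj R (subm (is_submod_range f)) M L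
    submod_incl f f_inj; first by rewrite range_submod_incl.
  apply: leq_ltn_trans (ltm _).
    apply: (dP L).2; apply: (kspans_onto (f := h)) spm => y.
    have [|x xy] := @submod_lift _ _ _ (is_submod_range f) (f y).
      by exists y.
    by exists x; apply: f_inj; rewrite hP.
  by apply: contrapT => /forallNP H; apply: f_nonto => y;
     have /contrapT[x _ <-] := H y; exists x.
- move=> M N f f_onto; apply: (dP N).2; exact: kspans_onto f_onto (dP M).1.
- move=> M N f f_onto f_ninj.
  have [/(kspans_submod (is_submod_ker f))[m [le_m _ _ gt0 spq]] _] := dP M.
  apply: leq_ltn_trans ((dP N).2 _ (spq _ _ f_onto _)) _ => //.
  (* The bound [d M - m] is strictly below [d M] only for positive [m]; the kernel being non-zero
     provides this. *)
  have m0 : (0 < m)%N.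
    apply: gt0; apply: contrapT => H; apply: f_ninj; apply: lin_inj => x fx.
    by apply: contrapT => x0; apply: H; exists x.
  by rewrite ltn_subrL m0 (leq_trans m0).
Qed.

End FiniteDimension.

(** * Submodules and subcategories in the presence of a dimension function *)

Section FiniteLength.
Variables (R : nzRingType) (d : fgMod R -> nat) (dimd : is_dimension d).
Implicit Types L M N X Y : fgMod R.

Definition fgsub M (P : set M) (sP : is_submod P) : fgMod R :=
  FGMod (let: And4 fg _ _ _ := dimd in fg M P sP).

(* Opaque, so that simplification does not unfold it to a projection. *)
Fact fgincl_subproof M (P : set M) (sP : is_submod P) :
  {f : {linear fgsub sP -> M} | injective f /\ range f = P}.
Proof.
exists submod_incl; split; first exact: (@submod_incl_inj _ _ _ sP).
exact: (range_submod_incl sP).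
Qed.

Definition fgincl M (P : set M) (sP : is_submod P) :
  {linear fgsub sP -> M} := sval (fgincl_subproof sP).

Lemma fgincl_inj M (P : set M) (sP : is_submod P) : injective (fgincl sP).
Proof. by rewrite /fgincl; case: fgincl_subproof => f []. Qed.

Lemma range_fgincl M (P : set M) (sP : is_submod P) : range (fgincl sP) = P.
Proof. by rewrite /fgincl; case: fgincl_subproof => f []. Qed.

Lemma fginclP M (P : set M) (sP : is_submod P) x : P (fgincl sP x).
Proof. by rewrite -[X in X _](range_fgincl sP); exists x. Qed.

Lemma fgincl_lift M (P : set M) (sP : is_submod P) x :
  P x -> exists y, fgincl sP y = x.
Proof. by rewrite -[X in X _](range_fgincl sP) => -[y _ <-]; exists y. Qed.

Lemma fgincl_factor X M (P : set M) (sP : is_submod P) (f : {linear X -> M}) :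
  (forall x, P (f x)) ->
  exists h : {linear X -> fgsub sP}, forall x, fgincl sP (h x) = f x.
Proof.
move=> Pf; apply: lin_factor_inj; first exact: fgincl_inj.
by rewrite range_fgincl => _ [x _ <-].
Qed.

Definition cycmod (M : lmodType R) (x : M) : fgMod R := FGMod (cyc_fg x).

Lemma dim_inj_lt L M (f : {linear L -> M}) :
  injective f -> ~ onto f -> (d L < d M)%N.
Proof. by case: dimd => _ + _ _; exact. Qed.

Lemma dim_onto_le M N (f : {linear M -> N}) : onto f -> (d N <= d M)%N.
Proof. by case: dimd => _ _ + _; exact. Qed.

Lemma dim_onto_lt M N (f : {linear M -> N}) :
  onto f -> ~ injective f -> (d N < d M)%N.
Proof. by case: dimd => _ _ _; exact. Qed.

Lemma dim_inj_le L M (f : {linear L -> M}) : injective f -> (d L <= d M)%N.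
Proof.
move=> f_inj; have [f_onto|/(dim_inj_lt f_inj)/ltnW//] := pselect (onto f).
have [g /bij_onto g_onto] : is_iso M L.
  by apply: is_iso_sym; exists f; apply: onto_inj_bij.
exact: dim_onto_le g_onto.
Qed.

Lemma inj_endo_onto M (f : {linear M -> M}) : injective f -> onto f.
Proof.
by move=> f_inj; apply: contrapT => /(dim_inj_lt f_inj); rewrite ltnn.
Qed.

Lemma submod_incl_le (M : lmodType R) (P Q : set M) (sP : is_submod P)
    (sQ : is_submod Q) : P `<=` Q ->
  exists h : {linear subm sP -> subm sQ},
    forall x, submod_incl (h x) = submod_incl x.
Proof.
move=> PQ; apply: lin_factor_inj; first exact: submod_incl_inj.
by rewrite !range_submod_incl.
Qed.

Lemma dim_sub_lt M (P Q : set M) (sP : is_submod P) (sQ : is_submod Q) x :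
  P `<=` Q -> Q x -> ~ P x -> (d (fgsub sP) < d (fgsub sQ))%N.
Proof.
move=> PQ Qx nPx; have [h hE] := submod_incl_le sP sQ PQ.
apply: (@dim_inj_lt (fgsub sP) (fgsub sQ) h).
  by move=> u v /(congr1 submod_incl); rewrite !hE; apply: submod_incl_inj.
move=> h_onto; have [z zx] := submod_lift sQ Qx; have [u uz] := h_onto z.
by apply: nPx; rewrite -zx -uz hE; apply: submod_inclP.
Qed.

(** A member of maximal dimension works, since a strictly larger submodule has strictly larger
    dimension. *)
Lemma submod_max M (Q : set M -> Prop) :
  (forall U, Q U -> is_submod U) -> (exists U, Q U) ->
  exists2 U, Q U & forall V, Q V -> U `<=` V -> V `<=` U.
Proof.
move=> subQ [U0 QU0].
pose S n := `[<exists U, Q U /\ exists sU : is_submod U, d (fgsub sU) = n>].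
have exS : exists n, S n.
  by exists (d (fgsub (subQ _ QU0))); apply/asboolP; exists U0; split=> //; eexists.
have ubS n : S n -> (n <= d M)%N.
  move=> /asboolP[U [QU [sU <-]]].
  exact: (dim_inj_le (@fgincl_inj _ _ sU)).
have [n /asboolP[U [QU [sU <-]]] maxU] := ex_maxnP exS ubS.
exists U => // V QV UV x Vx; apply: contrapT => nUx.
have := dim_sub_lt sU (subQ V QV) UV Vx nUx.
rewrite ltnNge maxU //; apply/asboolP; exists V; split=> //; by eexists.
Qed.

Lemma cycmod_le (M N : lmodType R) (x : M) (y : N) :
  (forall a, a *: x = 0 -> a *: y = 0) -> (d (cycmod y) <= d (cycmod x))%N.
Proof.
move=> ann.
have [||b u u' v v' [a [ua va]] [a' [ua' va']]|h hP] :=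
  @lin_of_rel R (cycmod x) (cycmod y) (fun u v => exists a,
    submod_incl u = a *: x /\ submod_incl v = a *: y).
- move=> u; have [a ua] := submod_inclP u.
  have [|v vy] := @submod_lift _ _ _ (cyc_submod y) (a *: y); first by exists a.
  by exists v, a.
- move=> v [a [/esym]]; rewrite linear0 => /ann -> v0.
  by apply: submod_incl_inj; rewrite linear0.
- by exists (b * a + a'); rewrite !linearP ua va ua' va' !scalerDl !scalerA.
apply: (@dim_onto_le (cycmod x) (cycmod y) h) => v.
have [a va] := submod_inclP v.
have [|u ux] := @submod_lift _ _ _ (cyc_submod x) (a *: x); first by exists a.
by exists u; apply/hP; exists a.
Qed.

Lemma cycmod_lt (M : lmodType R) (x y : M) :
  cyc x y -> ~ cyc y x -> (d (cycmod y) < d (cycmod x))%N.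
Proof.
move=> xy nyx.
have [h hE] := submod_incl_le (cyc_submod y) (cyc_submod x)
  (cyc_min (cyc_submod x) xy).
apply: (@dim_inj_lt (cycmod y) (cycmod x) h).
  by move=> u v /(congr1 submod_incl); rewrite !hE; apply: submod_incl_inj.
move=> h_onto; have [z zx] := submod_lift (cyc_submod x) (cyc_id x).
have [u uz] := h_onto z.
by apply: nyx; rewrite -zx -uz hE; apply: submod_inclP.
Qed.

(** The submodule [P] regarded as an object of [E]; by [sub_inE] the chosen embedding is immaterial
    for iso-closed [E]. *)
Definition sub_in (E : fgMod R -> Prop) M (P : set M) : Prop :=
  exists (L : fgMod R) (i : {linear L -> M}),
    [/\ injective i, range i = P & E L].

Section Subcategory.
Variable E : fgMod R -> Prop.
Hypothesis isoE : iso_closed E.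

Lemma sub_inE M (P : set M) L (i : {linear L -> M}) :
  sub_in E P -> injective i -> range i = P -> E L.
Proof.
move=> [L' [i' [i'_inj <- EL']]] i_inj ri; apply: isoE EL'.
have [|h hE] := lin_factor_inj (f := i') i_inj; first by rewrite ri.
exists h; apply: onto_inj_bij => [u v /(congr1 i)|x].
  by rewrite !hE; apply: i'_inj.
have : range i' (i x) by rewrite -ri; exists x.
by case=> y _ yx; exists y; apply: i_inj; rewrite hE.
Qed.

Lemma sub_in_fgsub M (P : set M) (sP : is_submod P) :
  sub_in E P <-> E (fgsub sP).
Proof.
split=> [EP|EP].
  exact: (sub_inE EP (@fgincl_inj _ _ sP) (range_fgincl sP)).
exists (fgsub sP), (fgincl sP); split=> //.
  exact: fgincl_inj.
exact: range_fgincl.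
Qed.

Lemma sub_inT M : sub_in E (@setT M) <-> E M.
Proof.
split=> [EM|EM].
  apply: (@sub_inE M setT M idfun EM) => //.
  by apply/seteqP; split=> // x _; exists x.
by exists M, idfun; split=> //; apply/seteqP; split=> // x _; exists x.
Qed.

Lemma sub_in_image L M (i : {linear L -> M}) (P : set L) :
  injective i -> sub_in E P -> sub_in E [set i x | x in P].
Proof.
move=> i_inj [K [j [j_inj <- EK]]]; exists K, (i \o j); split=> //.
  exact: inj_comp.
apply/seteqP; split=> [_ [x _ <-]|_ [_ [x _ <-] <-]]; last by exists x.
by exists (j x) => //; exists x.
Qed.

Hypothesis extE : ext_closed E.

Lemma sub_in_zero M (P : set M) :
  is_submod P -> (forall x, P x -> x = 0) -> sub_in E P.
Proof.
move=> sP P0; apply/(sub_in_fgsub sP); apply: extE.1 => x.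
by apply: (@fgincl_inj _ _ sP); rewrite linear0; apply/P0; apply: fginclP.
Qed.

(** The exact sequence behind this is [0 -> P -> Q -> g Q -> 0]. *)
Lemma sub_in_ext M Y (P Q : set M) (g : {linear M -> Y}) :
  is_submod Q -> P = [set x | Q x /\ g x = 0] ->
  sub_in E P -> sub_in E [set g x | x in Q] -> sub_in E Q.
Proof.
move=> sQ PE [K [i [i_inj ri EK]]] [I [j [j_inj rj EI]]].
apply/(sub_in_fgsub sQ).
have [|i' i'E] := @fgincl_factor _ _ _ sQ i.
  by move=> x; have : range i (i x) by [exists x]; rewrite ri PE => -[].
have [|g' g'E] := @lin_factor_inj R (fgsub sQ) Y I (g \o fgincl sQ) j j_inj.
  by rewrite rj => _ [x _ <-]; exists (fgincl sQ x) => //; apply: fginclP.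
apply: (extE.2 K (fgsub sQ) I i' g') => //; split.
- by move=> u v /(congr1 (fgincl sQ)); rewrite !i'E; apply: i_inj.
- move=> z; have : range j (j z) by exists z.
  rewrite rj => -[x /(fgincl_lift sQ)[y <-] yz].
  by exists y; apply: j_inj; rewrite g'E.
- apply/seteqP; split=> [_ [x _ <-]|y /= gy].
    apply: j_inj; rewrite g'E linear0 /= i'E.
    by have : range i (i x) by [exists x]; rewrite ri PE => -[].
  have : P (fgincl sQ y).
    rewrite PE; split; first exact: fginclP.
    by rewrite -[LHS]g'E gy linear0.
  by rewrite -ri => -[x _ xy]; exists x => //; apply: (@fgincl_inj _ _ sQ);
     rewrite i'E.
Qed.

End Subcategory.

Lemma ext_ker_im_left_schur (E : fgMod R -> Prop) :
  ext_ker_im_closed E -> left_schur E.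
Proof.
move=> [extE kerE imE]; split=> // M X f [EM M0 simM] EX.
pose K := fgsub (is_submod_ker f); pose I := fgsub (is_submod_range f).
have EK : E K.
  apply: (kerE M X f EM EX _ (fgincl _)); first exact: fgincl_inj.
  exact: range_fgincl.
have EI : E I.
  apply: (imE M X f EM EX _ (fgincl _)); first exact: fgincl_inj.
  exact: range_fgincl.
have [|g gE] := @fgincl_factor M X _ (is_submod_range f) f.
  by move=> x; exists x.
have [K0|K0] := pselect (is_zero K).
  right; apply: lin_inj => x /(fgincl_lift (is_submod_ker f))[y <-].
  by rewrite (K0 y) linear0.
have [I0|I0] := pselect (is_zero I).
  by left=> x; rewrite -gE (I0 (g x)) linear0.
exfalso; apply: simM; exists K, I, (fgincl _), g; split=> //; split.
- exact: fgincl_inj.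
- move=> z; have [x _ xz] := fginclP z.
  by exists x; apply: fgincl_inj; rewrite gE.
- rewrite range_fgincl; apply/seteqP; split=> x /= fx.
    by apply: fgincl_inj; rewrite gE linear0.
  by rewrite -gE fx linear0.
Qed.

(** A non-zero endomorphism of a simple object is injective by the Schur condition, hence bijective
    because a proper embedding raises the dimension. *)
Lemma left_schur_monobrick (E : fgMod R -> Prop) :
  iso_closed E -> left_schur E -> monobrick (sim E).
Proof.
move=> isoE [extE schurE]; split.
- move=> M N [f f_bij] [EM M0 simM].
  have [g fK gK] := bij_linear_inv f_bij.
  have g_inj := can_inj gK.
  split; first by apply: isoE EM; exists f.
    by move=> N0; apply: M0 => x; apply: (can_inj fK); rewrite (N0 (f x)) (N0 (f 0)).
  move=> [L [Q [i [q [[i_inj q_onto iq] EL EQ L0 Q0]]]]].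
  have qi y : q y = 0 <-> range i y by rewrite iq.
  apply: simM; exists L, Q, (g \o i), (q \o f); split=> //; split.
  + exact: inj_comp.
  + by move=> z; have [y <-] := q_onto z; exists (g y); rewrite /= gK.
  + apply/seteqP; split=> [_ [x _ <-]|x /qi[y _ yx]] /=; last first.
      by exists y => //=; rewrite yx fK.
    by rewrite gK; apply/qi; exists x.
- move=> M simM; split; first by case: simM.
  move=> f f0; have f_inj : injective f.
    by case: (simM) => EM _ _; have [|] := schurE M M f simM EM.
  have [|g gK] := @lin_factor_inj R M M M idfun f f_inj.
    by move=> y _; have [x xy] := inj_endo_onto f_inj y; exists x.
  by exists g; split=> x; [apply: f_inj|]; rewrite gK.
- by move=> M N f simM [EN _ _]; apply: schurE.
Qed.

End FiniteLength.

(** * Filtrations *)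

(** Filtrations built one top factor at a time turn arguments on chains into structural inductions;
    [filtP] compares them with [Filt]. *)
Inductive filt (R : nzRingType) (C : fgMod R -> Prop) : fgMod R -> Prop :=
| filt_zero (Z : fgMod R) : is_zero Z -> filt C Z
| filt_step (L M N : fgMod R) (f : {linear L -> M}) (g : {linear M -> N}) :
    short_exact f g -> filt C L -> C N -> filt C M.

Lemma short_exactP (R : nzRingType) (L M N : lmodType R) (f : {linear L -> M})
    (g : {linear M -> N}) :
  short_exact f g <->
  [/\ injective f, onto g & forall x, g x = 0 <-> exists y, f y = x].
Proof.
split=> -[f_inj g_onto fg]; split=> //.
  move=> x; split=> [gx|[y <-]].
    by have : [set x | g x = 0] x by []; rewrite -fg => -[y _ <-]; exists y.
  have : range f (f y) by exists y.
  by rewrite fg.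
apply/seteqP; split=> [_ [x _ <-]|x /fg[y <-]]; last by exists y.
by apply/fg; exists x.
Qed.

Section Filtrations.
Variables (R : nzRingType) (d : fgMod R -> nat) (dimd : is_dimension d).
Implicit Types L M N X Y : fgMod R.

Section FiltClosure.
Variable C : fgMod R -> Prop.

Lemma filt_iso : iso_closed (filt C).
Proof.
move=> M M' [h /bij_linear_inv[h' hK h'K]] fM.
case: fM h h' hK h'K => [Z Z0 h h' hK h'K|L {}M N f g].
  by apply: filt_zero => x; rewrite -(h'K x) (Z0 (h' x)) linear0.
move=> /short_exactP[f_inj g_onto fg] fL CN h h' hK h'K.
apply: (@filt_step _ _ L M' N (h \o f) (g \o h')) => //.
apply/short_exactP; split.
- by apply: inj_comp => //; apply: can_inj hK.
- by move=> y; have [x <-] := g_onto y; exists (h x); rewrite /= hK.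
- move=> x; split=> [/fg[y yx]|[y <-]].
    by exists y => /=; rewrite yx h'K.
  by apply/fg; exists y; rewrite /= hK.
Qed.

Lemma filt_in M : C M -> filt C M.
Proof.
move=> CM; pose Z := fgsub dimd (is_submod_zero M).
have Z0 : is_zero Z.
  move=> x; apply: (@fgincl_inj _ _ dimd); rewrite linear0.
  exact: (@fginclP _ _ dimd _ _ (is_submod_zero M) x).
apply: (@filt_step _ _ Z M M (fgincl _ _) idfun) => //; last exact: filt_zero.
apply/short_exactP; split=> [|y|x]; first exact: fgincl_inj.
  by exists y.
split=> /= [->|[y <-]]; last by rewrite (Z0 y) linear0.
by exists 0; rewrite linear0.
Qed.

(** Induct on the filtration of [N]. If its last step is [N' -> N -> Q], the preimage [M'] of [N']
    in [M] is an extension of [N'] by [L], and [M / M'] is [Q]. *)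
Lemma filt_ext : ext_closed (filt C).
Proof.
split=> [Z|L M N f g ex_fg fL fN]; first exact: filt_zero.
elim: fN M f g ex_fg => [Z Z0|N' {}N Q i q /short_exactP[i_inj q_onto iq] _ IH CQ]
  M f g /short_exactP[f_inj g_onto fg].
  apply: filt_iso fL; exists f; apply: onto_inj_bij => // x.
  by apply/fg; rewrite (Z0 (g x)).
pose P := [set x | range i (g x)].
have sP : is_submod P by apply: is_submod_preim; apply: is_submod_range.
pose M' := fgsub dimd sP.
have [|f' f'E] := fgincl_factor dimd sP (f := f).
  by move=> y; exists 0 => //; rewrite linear0; apply/esym/fg; exists y.
have [|g' g'E] := @lin_factor_inj R M' N N' (g \o fgincl dimd sP) i i_inj.
  by move=> _ [x _ <-]; exact: (@fginclP _ _ dimd M P sP x).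
have fM' : filt C M'.
  apply: (IH M' f' g'); apply/short_exactP; split.
  - by move=> u v /(congr1 (fgincl dimd sP)); rewrite !f'E; apply: f_inj.
  - move=> y; have [x xy] := g_onto (i y).
    have [|z zx] := @fgincl_lift _ _ dimd M P sP x; first by exists y.
    by exists z; apply: i_inj; rewrite g'E /= zx.
  - move=> x; split=> [g'x|[y <-]].
      have /fg[y yx] : g (fgincl dimd sP x) = 0 by rewrite -[LHS]g'E g'x linear0.
      by exists y; apply: (@fgincl_inj _ _ dimd _ _ sP); rewrite f'E.
    by apply: i_inj; rewrite g'E linear0 /= f'E; apply/fg; exists y.
apply: (@filt_step _ _ M' M Q (fgincl dimd sP) (q \o g)) => //.
apply/short_exactP; split=> [|y|x]; first exact: fgincl_inj.
  by have [z <-] := q_onto y; have [x <-] := g_onto z; exists x.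
split=> [/iq[y yx]|[y <-]].
  by apply: fgincl_lift; exists y.
by have [z _ zy] := @fginclP _ _ dimd M P sP y; apply/iq; exists z.
Qed.

Lemma filt_sub_ext (E : fgMod R -> Prop) : iso_closed E -> ext_closed E ->
  (forall M, C M -> E M) -> forall M, filt C M -> E M.
Proof.
move=> isoE [E0 extE] CE M; elim=> [Z Z0|L {}M N f g fg _ EL CN].
  exact: E0.
by apply: (extE L M N f g fg EL); apply: CE.
Qed.

(** In one direction, restrict the chain to its next-to-last member. In the other, push the chain of
    [L] forward along [f] and add [M] on top; this last inclusion is proper because [N] is
    non-zero. *)
Lemma filtP : (forall M, C M -> ~ is_zero M) -> forall M, Filt C M <-> filt C M.
Proof.
move=> C0 M; split.
  move=> [n]; elim: n M => [|n IH] M [X [sX X0 Xn XS]].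
    apply: filt_zero => x; have := Xn x.
    by rewrite X0 inE => /eqP.
  pose P := [set x | x \in X n].
  have sP : is_submod P by apply/is_submodP; apply: sX.
  pose S := fgsub dimd sP; pose i := fgincl dimd sP.
  have iP x : i x \in X n by exact: (@fginclP _ _ dimd M P sP x).
  have [_ _ [N CN [T [j [p [j_inj rj p_onto pj]]]]]] := XS n (ltnSn n).
  have j_onto : onto j.
    move=> x; have : range j x by rewrite rj /= Xn.
    by case=> y _; exists y.
  have [j' jK j'K] := bij_linear_inv (onto_inj_bij j_inj j_onto).
  apply: (@filt_step _ _ S M N i (p \o j')) => //.
    apply/short_exactP; split=> [|y|x]; first exact: fgincl_inj.
      by have [z <-] := p_onto y; exists (j z); rewrite /= jK.
    rewrite /= pj j'K; split=> [|[y <-]]; last exact: iP.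
    exact: fgincl_lift.
  pose Y m : {pred S} := fun s => i s \in X m.
  have YE m s : (s \in Y m) = (i s \in X m) by [].
  apply: IH; exists Y; split.
  - move=> m le_mn; apply/is_submodP.
    apply: (@is_submod_preim _ S M i [set x | x \in X m]).
    by apply/is_submodP/sX; rewrite ltnW.
  - move=> x; rewrite YE X0 inE; apply/eqP/eqP => [ix|->]; last exact: linear0.
    by apply: (@fgincl_inj _ _ dimd _ _ sP); rewrite linear0.
  - by move=> x; rewrite YE iP.
  - move=> m lt_mn.
    have [sub [x [xm1 xm]] [Q CQ [T' [j1 [p1 [j1_inj rj1 p1_onto p1j]]]]]] :=
      XS m (leq_trans lt_mn (leqnSn n)).
    have subX a b : (a <= b <= n)%N -> {subset X a <= X b}.
      elim: b => [|b IHb]; first by rewrite leqn0 => /andP[/eqP -> _] y.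
      move=> /andP[]; rewrite leq_eqVlt => /orP[/eqP -> _ y //|lt_ab] lt_bn y ya.
      have [sub_b _ _] := XS b (leq_trans lt_bn (leqnSn n)).
      by apply/sub_b/IHb => //; rewrite -ltnS lt_ab ltnW.
    have X1n y : y \in X m.+1 -> y \in X n by apply: subX; rewrite lt_mn /=.
    split.
    + by move=> y; rewrite !YE; apply: sub.
    + have [|y yx] := @fgincl_lift _ _ dimd M P sP x; first exact: X1n.
      by exists y; rewrite !YE /i yx.
    + exists Q => //.
      have [|h hE] := @lin_factor_inj R T' M S j1 i (@fgincl_inj _ _ dimd _ _ sP).
        rewrite range_fgincl => y; rewrite rj1; exact: X1n.
      exists T', h, p1; split=> //.
      * by move=> u v /(congr1 i); rewrite !hE; apply: j1_inj.
      * apply/seteqP; split=> [_ [u _ <-]|y] /=.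
          have : range j1 (j1 u) by exists u.
          by rewrite rj1 /= YE hE.
        rewrite YE => yX; have : range j1 (i y) by rewrite rj1.
        by case=> u _ uy; exists u => //; apply: (@fgincl_inj _ _ dimd _ _ sP);
           rewrite [LHS]hE.
      * by move=> s; rewrite p1j YE hE.
elim=> [Z Z0|L {}M N f g /short_exactP[f_inj g_onto fg] _ [n [X [sX X0 Xn XS]]] CN].
  exists 0%N, (fun=> predT : {pred Z}); split=> //.
  by move=> x; rewrite !inE (Z0 x) eqxx.
(* For [i <= n] this is [f (X i)]; the first disjunct makes it all of [M] at [n.+1]. *)
pose Y i : {pred M} :=
  fun x => (n < i)%N || `[<exists2 y, y \in X i & f y = x>].
have YP i x : (i <= n)%N -> x \in Y i <-> exists2 y, y \in X i & f y = x.
  rewrite leqNgt => /negbTE le_in; rewrite unfold_in /Y le_in /=.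
  by split=> /asboolP.
have Yn x : x \in Y n.+1 by rewrite unfold_in /Y ltnSn.
exists n.+1, Y; split=> //.
- move=> i; rewrite leq_eqVlt => /orP[/eqP ->|lt_in].
    by split=> [|a x y]; rewrite Yn.
  have YiE : [set x | x \in Y i] = [set f y | y in [set y | y \in X i]].
    by apply/seteqP; split=> x /YP; apply.
  have : is_submod [set x | x \in Y i].
    by rewrite YiE; apply: is_submod_image; apply/is_submodP; apply: sX.
  exact: (is_submodP (Y i)).1.
- move=> x; rewrite [RHS]inE; apply/idP/eqP => [/YP[//|y]|->].
    by rewrite X0 inE => /eqP -> <-; rewrite linear0.
  by apply/YP => //; exists 0; rewrite ?linear0 // X0 inE.
- move=> i; rewrite ltnS leq_eqVlt => /orP[/eqP ->|lt_in].
    split=> //.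
      have [z z0] : exists z : N, z <> 0.
        apply: contrapT => /forallNP N0; apply: (C0 N CN) => z.
        by apply: contrapT; apply: N0.
      have [x xz] := g_onto z; exists x; split=> //; apply/negP => /YP[//|y _ yx].
      by apply: z0; rewrite -xz; apply/fg; exists y.
    exists N => //; exists M, idfun, g; split=> // [|x].
      by apply/seteqP; split=> [x _ /=|x _]; [apply: Yn|exists x].
    rewrite fg; split=> [[y yx]|/YP[//|y _ yx]]; last by exists y.
    by apply/YP => //; exists y => //; rewrite Xn.
  have [sub [x [xm1 xm]] [Q CQ [T [j [p [j_inj rj p_onto pj]]]]]] := XS i lt_in.
  have le_in := ltnW lt_in.
  split.
  + move=> y /YP[//|z zX zy]; apply/YP => //; exists z => //; exact: sub.
  + exists (f x); split; first by apply/YP => //; exists x.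
    by apply/negP => /YP[//|y yX /f_inj yx]; move: xm; rewrite -yx yX.
  + exists Q => //; exists T, (f \o j), p; split=> //.
    * exact: inj_comp.
    * apply/seteqP; split=> [_ [u _ <-]|y /YP[//|z zX <-]] /=.
        apply/YP => //; exists (j u) => //.
        by have : range j (j u) by [exists u]; rewrite rj.
      have : range j z by rewrite rj.
      by case=> u _ <-; exists u.
    * move=> s; rewrite pj; split=> [js|/YP[//|z zX /f_inj <- //]].
      by apply/YP => //; exists (j s).
Qed.

End FiltClosure.

(** Consider the top factor [N] of [X]: an injective composite [M -> N] makes [f] injective, and a
    zero composite makes [f] factor through the previous filtration step. *)
Lemma monobrick_hom_filt (C : fgMod R -> Prop) M X (f : {linear M -> X}) :
  monobrick C -> C M -> filt C X -> zero_or_injective f.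
Proof.
move=> [_ _ homC] CM fX; elim: fX f => [Z Z0 f|L {}X N i g].
  by left=> x; apply: Z0.
move=> /short_exactP[i_inj g_onto ig] _ IH CN f.
have [gf0|gf_inj] := homC M N (g \o f) CM CN; last first.
  by right; apply: inj_compr gf_inj.
have [|h hE] := @lin_factor_inj R M X L f i i_inj.
  by move=> _ [x _ <-]; have /ig[y <-] := gf0 x; exists y.
case: (IH h) => [h0|h_inj]; [left|right] => [x|x y].
  by rewrite -hE h0 linear0.
by rewrite -!hE => /i_inj /h_inj.
Qed.

(** In a simple object the last filtration step has [L = 0], so the object is its top factor.
    Conversely, a quotient map from a member of [C] to a filtered module is zero or injective, so
    one end of the sequence vanishes. *)
Lemma sim_filt (C : fgMod R -> Prop) M : monobrick C -> sim (filt C) M <-> C M.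
Proof.
move=> mC; have [isoC brickC _] := mC; split=> [[fM M0 simM]|CM].
  case: fM M0 simM => [Z Z0|L {}M N f g fg fL CN M0 simM]; first by case.
  have N0 : ~ is_zero N by have [] := brickC N CN.
  have [L0|L0] := pselect (is_zero L); last first.
    by exfalso; apply: simM; exists L, N, f, g; split=> //; apply: filt_in.
  have [_ g_onto fgE] := (short_exactP f g).1 fg.
  apply: isoC CN; apply: is_iso_sym; exists g; apply: onto_inj_bij => //.
  by apply: lin_inj => x /fgE[y <-]; rewrite (L0 y) linear0.
have [M0 _] := brickC M CM.
split=> //; first exact: filt_in.
move=> [L [N [f [g [/short_exactP[f_inj g_onto fg] fL fN L0 N0]]]]].
have [g0|g_inj] := monobrick_hom_filt g mC CM fN.
  by apply: N0 => y; have [x <-] := g_onto y; apply: g0.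
apply: L0 => x; apply: f_inj; apply: g_inj; rewrite !linear0.
by apply/fg; exists x.
Qed.

Lemma filt_sim (E : fgMod R -> Prop) M :
  iso_closed E -> ext_closed E -> filt (sim E) M <-> E M.
Proof.
move=> isoE extE; split.
  by apply: filt_sub_ext => // N [].
have [n] := ubnP (d M); elim: n M => // n IH M /ltnSE le_n EM.
have [M0|M0] := pselect (is_zero M); first exact: filt_zero.
have [simM|nsimM] := pselect (sim E M); first exact: filt_in.
have [L [N [f [g [fg EL EN L0 N0]]]]] : exists (L N : fgMod R)
    (f : {linear L -> M}) (g : {linear M -> N}),
    [/\ short_exact f g, E L, E N, ~ is_zero L & ~ is_zero N].
  by apply: contrapT => nM; apply: nsimM.
have [f_inj g_onto fgE] := (short_exactP f g).1 fg.
have [_ extF] := filt_ext (sim E).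
apply: (extF L M N f g fg).
  apply: IH => //; apply: leq_trans le_n; apply: (dim_inj_lt dimd f_inj) => f_onto.
  apply: N0 => z; have [x <-] := g_onto z; apply/fgE; exact: f_onto.
apply: IH => //; apply: leq_trans le_n; apply: (dim_onto_lt dimd g_onto) => g_inj.
apply: L0 => x; apply: f_inj; apply: g_inj; rewrite !linear0.
by apply/fgE; exists x.
Qed.

End Filtrations.

(** * Primitive idempotents and bricks *)

Section Idempotents.
Variable R : nzRingType.

(** The conditions on [a] and [b] mean membership in [R e]: this is uniseriality of [R e] in terms
    of elements. *)
Definition left_serial (e : R) : Prop :=
  forall a b, a * e = a -> b * e = b ->
    (exists c, a = c * b) \/ (exists c, b = c * a).

Definition right_serial (e : R) : Prop :=
  forall a b, e * a = a -> e * b = b ->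
    (exists c, a = b * c) \/ (exists c, b = a * c).

(** Here [u] ranges over the idempotents of the corner ring [e R e]. *)
Definition primitive_idem (e : R) : Prop :=
  [/\ e <> 0, e * e = e &
      forall u, u * u = u -> e * u = u -> u * e = u -> u = 0 \/ u = e].

Definition regmod : lmodType R := R^o.

Lemma regmodE (a : R) (b : regmod) : a *: b = a * b :> R.
Proof. by []. Qed.

Section Primitive.
Variable e : R.
Hypothesis prim_e : primitive_idem e.

Let P : fgMod R := cycmod (e : regmod).
Let i : {linear P -> regmod} := submod_incl.
Let i_inj : injective i := @submod_incl_inj _ _ _ (cyc_submod (e : regmod)).

Let iP x : (i x : R) * e = i x.
Proof.
have [a ->] := @submod_inclP _ _ _ (cyc_submod (e : regmod)) x.
by case: prim_e => _ ee _; rewrite regmodE -mulrA ee.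
Qed.

Let i_lift (a : R) : a * e = a -> exists x, i x = a.
Proof. by move=> ae; apply: submod_lift; exists a; rewrite regmodE ae. Qed.

(** The lift sends [x] in [R e] to [x *: m], where [m] lifts the image of [e]; it is a lift of [h]
    because [x = x e]. *)
Lemma primitive_projective : projective P.
Proof.
move=> M N g h g_onto.
have [eP ePE] : exists x, i x = e by apply: i_lift; case: prim_e.
have [m gm] := g_onto (h eP).
have [|y|a x x' y y'|h' h'E] := @lin_of_rel R P M
  (fun x y => y = (i x : R) *: m).
- by move=> x; eexists.
- by rewrite linear0 scale0r.
- by move=> -> ->; rewrite linearP scalerDl scalerA.
exists h' => x; have /h'E -> // : (i x : R) *: m = (i x : R) *: m by [].
rewrite linearZZ gm -linearZZ; congr (h _).
by apply: i_inj; rewrite linearZZ ePE regmodE iP.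
Qed.

(** Write [e = u + v] along a decomposition. Uniqueness of components gives [e u = u] and [u u = u],
    so [u] is [0] or [e], and one summand vanishes. *)
Lemma primitive_indecomposable : indecomposable P.
Proof.
have [e0 ee prim] := prim_e.
have [eP ePE] : exists x, i x = e by apply: i_lift.
have gen x : x = (i x : R) *: eP.
  by apply: i_inj; rewrite linearZZ ePE regmodE iP.
split=> [P0|U V /is_submodP sU /is_submodP sV UV0 UV].
  by apply: e0; rewrite -ePE (P0 eP) linear0.
have [u [v [uU vV uv]]] := UV eP.
have dec u' v' : u' \in U -> v' \in V -> u' + v' = 0 -> u' = 0.
  move=> u'U v'V /eqP; rewrite addr_eq0 => /eqP u'v'.
  apply: UV0 => //; rewrite u'v' -scaleN1r; exact: (is_submodZ _ sV).
have uvE : (i u : R) + i v = e by rewrite -ePE uv linearD.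
have euE : e *: u = u.
  apply/eqP; rewrite -subr_eq0; apply/eqP; apply: (dec _ (e *: v - v)).
  - by apply: (is_submodB sU) => //; apply: (is_submodZ _ sU).
  - by apply: (is_submodB sV) => //; apply: (is_submodZ _ sV).
  - rewrite addrACA -scalerDr -opprD -uv.
    by apply: i_inj; rewrite linearB linearZZ ePE regmodE ee subrr linear0.
have uuE : (i u : R) *: u = u.
  apply/eqP; rewrite -subr_eq0; apply/eqP; apply: (dec _ ((i u : R) *: v)).
  - by apply: (is_submodB sU) => //; apply: (is_submodZ _ sU).
  - exact: (is_submodZ _ sV).
  - by rewrite addrAC -scalerDr -uv -gen subrr.
have [|||u0|ue] := prim (i u).
- by rewrite -[in RHS]uuE linearZZ.
- by rewrite -[in RHS]euE linearZZ.
- exact: iP.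
- have {}u0 : u = 0 by apply: i_inj; rewrite u0 linear0.
  left=> x xU; apply: UV0 => //; rewrite (gen x) uv u0 add0r.
  exact: (is_submodZ _ sV).
- have {}ue : u = eP by apply: i_inj; rewrite ue ePE.
  right=> x xV; apply: UV0 => //; rewrite (gen x) -ue.
  exact: (is_submodZ _ sU).
Qed.

Lemma primitive_left_serial : serial_ring R -> left_serial e.
Proof.
move=> serR a b ae be.
have uniP := serR P primitive_projective primitive_indecomposable.
have [x xa] := i_lift ae; have [y yb] := i_lift be.
have sub u : submod_closed (subm_pred (cyc u) : {pred P}).
  exact: (subm_closed (cyc_submod u)).
have inE' u v : v \in (subm_pred (cyc u) : {pred P}) <-> exists c, v = c *: u.
  by split=> /asboolP.
have [sxy|syx] := uniP _ _ (sub x) (sub y); [left|right].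
- have /sxy/inE'[c xE] : x \in subm_pred (cyc x).
    by apply/inE'; exists 1; rewrite scale1r.
  by exists c; rewrite -xa xE linearZZ yb.
- have /syx/inE'[c yE] : y \in subm_pred (cyc y).
    by apply/inE'; exists 1; rewrite scale1r.
  by exists c; rewrite -yb yE linearZZ xa.
Qed.

End Primitive.

(** Induct on the dimension of [R e]: a non-primitive non-zero [e] splits as [u + (e - u)], two
    idempotents generating strictly smaller left ideals. *)
Lemma primitive_decomposition (d : fgMod R -> nat) (dimd : is_dimension d)
    (e : R) : e * e = e ->
  exists p : seq R, \sum_(f <- p) f = e /\ forall f, f \in p -> primitive_idem f.
Proof.
have [n] := ubnP (d (cycmod (e : regmod))).
elim: n e => // n IH e /ltnSE le_n ee.
have [e0|e0] := pselect (e = 0); first by exists [::]; rewrite big_nil.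
have [prim|nprim] := pselect (primitive_idem e).
  by exists [:: e]; split=> [|f]; rewrite ?big_seq1 // inE => /eqP ->.
have [u [uu eu ue u0 une]] : exists u, [/\ u * u = u, e * u = u, u * e = u,
    u <> 0 & u <> e].
  apply: contrapT => nu; apply: nprim; split=> // u uu eu ue.
  have [|u0] := pselect (u = 0); first by left.
  by right; apply: contrapT => une; apply: nu; exists u.
have part v : v * v = v -> v * e = v -> e * v = v -> v <> e ->
    (d (cycmod (v : regmod)) < n)%N.
  move=> vv ve ev vne; apply: leq_trans le_n; apply: (cycmod_lt dimd).
    by exists v; rewrite regmodE ve.
  by move=> [c ec]; apply: vne; rewrite -ev ec regmodE -mulrA vv.
have [p [pE pP]] := IH u (part u uu ue eu une) uu.
have eu_idem : (e - u) * (e - u) = e - u.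
  by rewrite mulrBl !mulrBr ee eu ue uu subrr subr0.
have [|q [qE qP]] := IH (e - u) _ eu_idem.
  apply: part => //; [by rewrite mulrBl ee ue|by rewrite mulrBr ee eu|].
  by move=> /eqP; rewrite -subr_eq0 addrAC subrr add0r oppr_eq0 => /eqP.
exists (p ++ q); rewrite big_cat /= pE qE addrC subrK; split=> // f.
by rewrite mem_cat => /orP[/pP|/qP].
Qed.

End Idempotents.

(** * Cyclicity of bricks over a ring with serial idempotents *)

Section CyclicBricks.
Variables (R : nzRingType) (d : fgMod R -> nat) (dimd : is_dimension d).
Variable p : seq R.
Hypothesis sum_p : \sum_(e <- p) e = 1.
Hypothesis idem_p : forall e, e \in p -> e * e = e.
Hypothesis left_p : forall e, e \in p -> left_serial e.
Hypothesis right_p : forall e, e \in p -> right_serial e.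
Implicit Types M : fgMod R.

(** As [x] is the sum of the [e *: x], one of them escapes [P]; this reduces questions to elements
    fixed by an idempotent. *)
Lemma idem_notin (M : lmodType R) (P : set M) x :
  is_submod P -> ~ P x -> exists2 e, e \in p & ~ P (e *: x).
Proof.
move=> sP nPx; apply: contrapT => nex; apply: nPx.
rewrite -[x]scale1r -sum_p scaler_suml big_seq.
apply: big_ind => [|u v|e ep]; [exact: is_submod0|exact: is_submodD|].
by apply: contrapT => nPe; apply: nex; exists e.
Qed.

Lemma cycmod_dim_le M (x : M) : (d (cycmod x) <= d M)%N.
Proof.
exact: (@dim_inj_le _ _ dimd (cycmod x) M submod_incl (@submod_incl_inj _ _ _ _)).
Qed.

Lemma max_cyclic M : ~ is_zero M ->
  exists e x, [/\ e \in p, e *: x = x :> M, x <> 0 &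
    forall f (y : M), f \in p -> f *: y = y -> (d (cycmod y) <= d (cycmod x))%N].
Proof.
move=> M0.
pose S n := `[<exists e (x : M),
  [/\ e \in p, e *: x = x, x <> 0 & d (cycmod x) = n]>].
have exS : exists n, S n.
  have [z z0] : exists z : M, z <> 0.
    by apply: contrapT => /forallNP nz; apply: M0 => z; apply: contrapT; apply: nz.
  have [e ep ez] := idem_notin (@is_submod_zero R M) z0.
  exists (d (cycmod (e *: z))); apply/asboolP; exists e, (e *: z); split=> //.
  by rewrite scalerA idem_p.
have ubS n : S n -> (n <= d M)%N.
  by move=> /asboolP[e [x [_ _ _ <-]]]; apply: cycmod_dim_le.
have [n /asboolP[e [x [ep ex x0 <-]]] maxn] := ex_maxnP exS ubS.
exists e, x; split=> // f y fp fy.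
have [->|y0] := pselect (y = 0).
  by apply: (cycmod_le dimd) => a _; rewrite scaler0.
by apply: maxn; apply/asboolP; exists f, y.
Qed.

(* The left ideal [{a in R f | P (a *: y)}] is generated by [r]. *)
Lemma conductor_generator (M : lmodType R) (P : set M) f y :
  is_submod P -> f \in p -> f *: y = y ->
  exists g r, [/\ g \in p, g * r = r, r * f = r, P (r *: y) &
    forall b, P (b *: y) -> exists c, b * f = c * r].
Proof.
move=> sP fp fy; pose RR : fgMod R := cycmod (1 : regmod R).
pose Q (U : set RR) := exists g (r : RR), [/\ g \in p, g *: r = r,
  (submod_incl r : R) * f = submod_incl r, P ((submod_incl r : R) *: y) &
  U = cyc r].
have [||U [g [r [gp gr rf rP UE]]] maxU] := submod_max dimd (M := RR) (Q := Q).
- by move=> U [g [r [_ _ _ _ ->]]]; apply: cyc_submod.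
- exists (cyc (0 : RR)), f, 0; split; rewrite ?scaler0 // linear0.
    by rewrite mul0r.
  by rewrite scale0r; apply: is_submod0.
exists g, (submod_incl r); split=> //.
  by rewrite -[in RHS]gr linearZZ.
move=> b Pb.
pose J : set (regmod R) := [set a | exists c, a = c * (submod_incl r : R)].
have sJ : is_submod J.
  split=> [|a _ _ [c ->] [c' ->]]; first by exists 0; rewrite mul0r.
  by exists (a * c + c'); rewrite mulrDl -mulrA.
suff : J (b * f) by [].
(* If some [h b f] is not a multiple of [r], seriality of [f] makes [r] a multiple of it; maximality
   of [R r] then puts [h b f] back in [R r]. *)
apply: contrapT => /(idem_notin sJ)[h hp]; apply.
have [|s sE] := @submod_lift _ _ _ (cyc_submod (1 : regmod R)) (h * (b * f)).
  by exists (h * (b * f)); rewrite regmodE mulr1.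
have [||[c sc]|[c rE]] :=
  left_p fp (a := h * (b * f)) (b := submod_incl r).
- by rewrite -!mulrA idem_p.
- exact: rf.
- by exists c; rewrite -sc.
have Qs : Q (cyc s).
  exists h, s; split=> //.
  - by apply: submod_incl_inj; rewrite linearZZ sE regmodE mulrA idem_p.
  - by rewrite sE -!mulrA idem_p.
  - by rewrite sE -!scalerA fy; apply: is_submodZ.
have rs : r = c *: s.
  by apply: submod_incl_inj; rewrite linearZZ sE; exact: rE.
have sub_rs : cyc r `<=` cyc s.
  by apply: cyc_min; [exact: cyc_submod|exists c].
have [c' sr] : cyc r s.
  by rewrite -UE; apply: (maxU _ Qs); rewrite ?UE //; exact: cyc_id.
by exists c'; rewrite -[LHS]sE sr linearZZ.
Qed.

(* If [y = f y] is outside [U + R x], with [r y = u + s x] and [r] generating the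
   conductor of [y], it is enough to find [t] such that [r (y - t x)] lies in [U]:
   then [U + R (y - t x)] contradicts the maximality of [U].  Compare [r] and [s] in
   [g R]: if [s = r t], take this [t]; if [r = s t], then [t y] modulo [U] and [x]
   have the same annihilator, so [R t y = R y] by maximality of [R x], and [t] is
   replaced by [c] with [y = c t y]. *)
Lemma max_cyclic_complement M e (x : M) (U : set M) :
  e \in p -> e *: x = x ->
  (forall f (y : M), f \in p -> f *: y = y -> (d (cycmod y) <= d (cycmod x))%N) ->
  is_submod U -> (forall y, U y -> cyc x y -> y = 0) ->
  (forall V, is_submod V -> (forall y, V y -> cyc x y -> y = 0) ->
     U `<=` V -> V `<=` U) ->
  forall y, addmod U (cyc x) y.
Proof.
move=> ep ex maxx sU Ux0 maxU z; apply: contrapT.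
pose W := addmod U (cyc x).
have sW : is_submod W by apply: addmod_submod => //; apply: cyc_submod.
have UW u : U u -> W u.
  by move=> Uu; exists u, 0; rewrite addr0; split=> //; exists 0; rewrite scale0r.
have xW a : W (a *: x).
  by exists 0, (a *: x); rewrite add0r; split=> //; [exact: is_submod0|exists a].
move=> /(idem_notin sW)[f fp]; set y := f *: z => nWy.
have fy : f *: y = y by rewrite scalerA idem_p.
clearbody y.
have [g [r [gp gr rf [u0 [_ [Uu0 [s0 ->] ryE]]] rgen]]] :=
  conductor_generator sW fp fy.
have {Uu0 ryE} [u [s [Uu gs se ryE]]] : exists u s,
    [/\ U u, g * s = s, s * e = s & r *: y = u + s *: x].
  (* The factors [g] and [e] put [s] in [g R e], so that seriality of both idempotents applies to
     it. *)
  exists (g *: u0), (g * s0 * e); split; first exact: is_submodZ.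
  - by rewrite !mulrA idem_p.
  - by rewrite -mulrA idem_p.
  - by rewrite -!scalerA ex -scalerDr -ryE scalerA gr.
suff [t ft tU] : exists2 t, f * t = t & U (r *: (y - t *: x)).
  apply: nWy; rewrite -[y](subrK (t *: x)); apply: is_submodD => //.
  set y' := y - t *: x in tU *; apply: (UW).
  have fy' : f *: y' = y' by rewrite scalerBr fy scalerA ft.
  have y'U : addmod U (cyc y') `<=` U.
    apply: maxU; first by apply: addmod_submod => //; apply: cyc_submod.
      move=> _ [u1 [_ [Uu1 [b ->] ->]]] bx; apply: Ux0 => //.
      apply: is_submodD => //.
      (* If [u1 + b y'] lies in [R x], then [b y] lies in [W], so [b f] is a multiple of [r] and
         [b y' = b f y'] lies in [U]. *)
      have [c bf] : exists c, b * f = c * r.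
        apply: rgen; rewrite -[y](subrK (t *: x)) scalerDr scalerA.
        apply: (is_submodD sW) => //.
        have -> : b *: y' = (u1 + b *: y') - u1 by rewrite addrC addKr.
        by apply: is_submodB; [|case: bx => a ->|exact: UW].
      by rewrite -fy' scalerA bf -scalerA; apply: is_submodZ.
    by move=> v Uv; exists v, 0; rewrite addr0; split=> //; exists 0; rewrite scale0r.
  by apply: y'U; exists 0, y'; rewrite add0r; split=> //; [exact: is_submod0|exact: cyc_id].
have [sx0|sx0] := pselect (s *: x = 0).
  by exists 0; rewrite ?mulr0 // scale0r subr0 ryE sx0 addr0.
have [[t0 rE0]|[t sE]] := right_p gp gr gs; last first.
  exists (f * t * e); first by rewrite !mulrA idem_p.
  have -> : r *: (y - (f * t * e) *: x) = u; last by [].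
  rewrite scalerBr ryE scalerA !mulrA rf -mulrA mulrA -sE se.
  by rewrite addrK.
pose t := e * t0 * f.
have rE : r = s * t by rewrite !mulrA se -rE0 rf.
pose q := t *: y.
have sq : s *: q = u + s *: x by rewrite scalerA -rE.
have eq : e *: q = q by rewrite scalerA !mulrA idem_p.
(* If [a] is a multiple of [s], then [a q] and [a x] differ by an element of [U]. Otherwise [s] is a
   multiple of [a], and either side would force [s x = 0]. *)
have annU a : a * e = a -> a *: x = 0 <-> U (a *: q).
  move=> ae; have [[c aE]|[c sa]] := left_p ep ae se.
    have aq : a *: q = c *: u + a *: x by rewrite aE -!scalerA sq scalerDr.
    split=> [ax0|Uaq]; first by rewrite aq ax0 addr0; apply: is_submodZ.
    apply: Ux0; last by exists a.
    have -> : a *: x = a *: q - c *: u by rewrite aq addrC addKr.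
    by apply: is_submodB => //; apply: is_submodZ.
  split=> [ax0|Uaq]; first by case: sx0; rewrite sa -scalerA ax0 scaler0.
  case: sx0; apply: Ux0; last by exists s.
  have -> : s *: x = s *: q - u by rewrite sq addrC addKr.
  by apply: is_submodB => //; rewrite sa -scalerA; apply: is_submodZ.
have le_yq : (d (cycmod y) <= d (cycmod q))%N.
  apply: leq_trans (maxx f y fp fy) _; apply: (cycmod_le dimd) => a aq0.
  have /annU : (a * e) * e = a * e by rewrite -mulrA idem_p.
  by rewrite -!scalerA ex eq aq0 => -[_]; apply; apply: is_submod0.
have [c yE] : cyc q y.
  apply: contrapT => nqy; have yq : cyc y q by exists t.
  by have := cycmod_lt dimd yq nqy; rewrite ltnNge le_yq.
have [c' [fc' ce' yE']] : exists c', [/\ f * c' = c', c' * e = c' & y = c' *: q].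
  exists (f * c * e); split; [by rewrite !mulrA idem_p|by rewrite -mulrA idem_p|].
  by rewrite -!scalerA eq -yE fy.
(* Since [(r c' - s) q = r y - (u + s x) = 0], the element [r c' - s] also kills [x], whence
   [r (y - c' x) = u]. *)
exists c' => //; have /annU : (r * c' - s) * e = r * c' - s.
  by rewrite mulrBl se -mulrA ce'.
rewrite !scalerBl -!scalerA -yE' sq -ryE subrr => -[_ /(_ (is_submod0 sU))].
by move=> /eqP; rewrite subr_eq0 scalerBr ryE => /eqP ->; rewrite addrK.
Qed.

(** The projection onto a complement [U] of a maximal [R x] is an endomorphism killing [x]; it is
    not invertible, so it is zero and [M = R x]. *)
Lemma brick_cyclic M : brick M ->
  exists e x, [/\ e \in p, e *: x = x :> M & forall y, cyc x y].
Proof.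
move=> [M0 brickM]; have [e [x [ep ex x0 maxx]]] := max_cyclic M0.
pose Q (U : set M) := is_submod U /\ forall y, U y -> cyc x y -> y = 0.
have [||U [sU Ux0] maxU] := submod_max dimd (M := M) (Q := Q).
- by move=> U [].
- by exists [set 0]; split=> //; exact: is_submod_zero.
have UxT : forall y, addmod U (cyc x) y.
  by apply: (max_cyclic_complement ep) => // V sV Vx0; apply: maxU.
exists e, x; split=> // y.
have [|z|a z z' w w'|f fE] := @lin_of_rel R M M (fun z w => U w /\ cyc x (z - w)).
- by move=> z; have [u [v [Uu xv ->]]] := UxT z; exists u; rewrite addrC addKr.
- move=> [Uz]; rewrite sub0r => xz; apply: Ux0 => //.
  by rewrite -[z]opprK -scaleN1r; apply: is_submodZ => //; exact: cyc_submod.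
- move=> [Uw xzw] [Uw' xzw']; split; first exact: sU.2.
  rewrite opprD addrACA -scalerBr; exact: (cyc_submod x).2.
have [f0|nf0] := pselect (forall z, f z = 0).
  by have /fE[_] := f0 y; rewrite subr0.
have [g [fK _]] := brickM f nf0.
case: x0; rewrite -[x]fK -[RHS](linear0 g); congr (g _).
by apply/fE; split; [exact: is_submod0|rewrite subr0; exact: cyc_id].
Qed.

End CyclicBricks.

(** * Kernels and images *)

Section MonobrickClosure.
Variables (R : nzRingType) (d : fgMod R -> nat) (dimd : is_dimension d).
Implicit Types L M N X Y : fgMod R.

(** Such an [M] is a quotient of [R e] and inherits comparability of elements from it. *)
Definition serial_cyclic M : Prop := exists e (x : M),
  [/\ e * e = e, left_serial e, e *: x = x & forall y, cyc x y].

Lemma serial_cyclic_chain N (y z : N) : serial_cyclic N -> cyc y z \/ cyc z y.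
Proof.
move=> [e [x [ee ser ex gen]]]; have [a ->] := gen y; have [b ->] := gen z.
rewrite -ex !scalerA.
have [||[c aE]|[c bE]] := ser (a * e) (b * e); rewrite -?mulrA ?ee //.
  by right; exists c; rewrite aE scalerA.
by left; exists c; rewrite bE scalerA.
Qed.

(** If [a] kills [y] but not [x], and [b] kills [x], then [a e] is not a multiple of [b e]; so [b e]
    is a multiple of [a e], and [b] kills [y]. *)
Lemma serial_ann_chain (M N : lmodType R) e (x : M) (y : N) :
  e * e = e -> left_serial e -> e *: x = x -> e *: y = y ->
  (forall a, a *: x = 0 -> a *: y = 0) \/ (forall a, a *: y = 0 -> a *: x = 0).
Proof.
move=> ee ser ex ey.
have [|/existsNP[a /not_implyP[ay0 ax0]]] :=
  pselect (forall a, a *: y = 0 -> a *: x = 0); first by right.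
left=> b bx0; have [||[c aE]|[c bE]] := ser (a * e) (b * e); rewrite -?mulrA ?ee //.
  by case: ax0; rewrite -ex scalerA aE -!scalerA ex bx0 scaler0.
by rewrite -ey scalerA bE -!scalerA ey ay0 scaler0.
Qed.

Lemma lin_cyclic (X Y : lmodType R) (x : X) (y : Y) :
  (forall z, cyc x z) -> (forall a, a *: x = 0 -> a *: y = 0) ->
  exists h : {linear X -> Y}, h x = y.
Proof.
move=> gen ann.
have [z|z [a [/esym /ann -> //]]|a z z' w w'|h hE] :=
  @lin_of_rel R X Y (fun z w => exists a, z = a *: x /\ w = a *: y).
- by have [a ->] := gen z; exists (a *: y), a.
- move=> [b [-> ->]] [b' [-> ->]]; exists (a * b + b').
  by rewrite !scalerDl !scalerA.
- by exists h; apply/hE; exists 1; rewrite !scale1r.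
Qed.

Variable C : fgMod R -> Prop.
Hypothesis monoC : monobrick C.
Hypothesis cycC : forall N, C N -> serial_cyclic N.

Let isoF : iso_closed (filt C) := @filt_iso R C.
Let extF : ext_closed (filt C) := filt_ext dimd C.

(** Kernel and image go through the induction jointly: each case calls on the other for a smaller
    module. *)
Let KI X Y (f : {linear X -> Y}) : Prop :=
  sub_in (filt C) [set x | f x = 0] /\ sub_in (filt C) (range f).

(* Let [L] be the bottom of a filtration step [L -> X -> M] and [K = ker f].  Then
   [ker f] is an extension of [g K] by [ker (f i)], so the point is to find [g K]
   and [f X] in [filt C].  If [g K <> M], then [f X] is cyclic on [y = f x], where
   [x] lifts a generator [m] of [M], and comparing annihilators yields
   [phi : f X -> M] sending [y] to [m] (the other direction would give a
   non-injective non-zero map [M -> N]).  It satisfies [phi (f L) = g K] and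
   [ker phi <= f L], which reduces both claims to modules smaller than [X]. *)
Lemma filt_hom_mono X N (f : {linear X -> N}) : filt C X -> C N -> KI f.
Proof.
have [n] := ubnP (d X); elim: n X N f => // n IH X N f /ltnSE le_n fX CN.
case: fX f le_n => [Z Z0 f _|L {}X M i g ex fL CM f le_n].
  split.
    by apply: (sub_in_zero dimd isoF extF); [exact: is_submod_ker|].
  apply: (sub_in_zero dimd isoF extF); first exact: is_submod_range.
  by move=> _ [z _ <-]; rewrite (Z0 z) linear0.
have [i_inj g_onto ig] := (short_exactP i g).1 ex.
have [isoC brickC homC] := monoC.
have [M0 _] := brickC M CM.
have fX : filt C X by apply: filt_step ex fL CM.
have lt_L : (d L < d X)%N.
  apply: (dim_inj_lt dimd i_inj) => i_onto; apply: M0 => m.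
  by have [x <-] := g_onto m; apply/ig; exact: i_onto.
have [kfi rfi] := IH L N (f \o i) (leq_trans lt_L le_n) fL CN.
have ker_f : sub_in (filt C) [set g x | x in [set x | f x = 0]] ->
    sub_in (filt C) [set x | f x = 0].
  apply: (sub_in_ext dimd isoF extF (P := [set i x | x in [set x | (f \o i) x = 0]])).
  - exact: is_submod_ker.
  - apply/seteqP; split=> [_ [y /= fiy <-]|x /= [fx /ig[y yx]]].
      by split=> //; apply/ig; exists y.
    by exists y => //=; rewrite yx.
  - exact: sub_in_image.
(* If [g K = M], every element of [X] can be moved into [L] by subtracting an element of [K], so
   [f X = f L]. *)
have [gK|/existsNP[m1 ngK]] := pselect (forall m, exists2 x, f x = 0 & g x = m).
  split.
    apply: ker_f; have -> : [set g x | x in [set x | f x = 0]] = setT.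
      by apply/seteqP; split=> // m _; have [x fx gx] := gK m; exists x.
    by apply/(sub_inT isoF); exact: (filt_in dimd CM).
  have -> // : range f = range (f \o i).
  apply/seteqP; split=> [_ [x _ <-]|_ [y _ <-]]; last by exists (i y).
  have [z fz gz] := gK (g x); have /ig[y yE] : g (x - z) = 0.
    by rewrite linearB gz subrr.
  by exists y => //=; rewrite yE linearB fz subr0.
have [e [m [ee ser em genM]]] := cycC CM.
have [x1 gx1] := g_onto m; pose x := e *: x1.
have gx : g x = m by rewrite linearZZ gx1.
have ex0 : e *: x = x by rewrite scalerA ee.
clearbody x; pose y := f x.
have ey : e *: y = y by rewrite -linearZZ ex0.
(* If [y = f (i z)], then [x - i z] lies in [K] and maps to the generator [m], so [g K = M]. *)
have nfiy z : f (i z) <> y.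
  move=> fiz; apply: ngK; have [a m1E] := genM m1.
  exists (a *: (x - i z)); first by rewrite linearZZ linearB fiz subrr scaler0.
  have giz : g (i z) = 0 by apply/ig; exists z.
  by rewrite linearZZ linearB giz gx subr0.
have fi_y z : cyc y (f (i z)).
  have [//|[a yE]] := serial_cyclic_chain y (f (i z)) (cycC CN).
  by case: (nfiy (a *: z)); rewrite !linearZZ.
have dec x2 : exists a z, x2 = a *: x + i z.
  have [a gx2] := genM (g x2); have /ig[z zE] : g (x2 - a *: x) = 0.
    by rewrite linearB linearZZ gx2 gx subrr.
  by exists a, z; rewrite zE addrC subrK.
have f_y x2 : cyc y (f x2).
  have [a [z ->]] := dec x2; rewrite linearD linearZZ.
  by apply: is_submodD; [exact: cyc_submod|exists a|exact: fi_y].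
have ann a : a *: y = 0 -> a *: m = 0.
  have [ann_m|ann_y] := serial_ann_chain ee ser em ey; last exact: ann_y.
  have [psi psim] := lin_cyclic genM ann_m.
  move=> ay0; have [psi0|psi_inj] := homC M N psi CM CN.
    by case: (nfiy 0); rewrite !linear0 -psim psi0.
  by apply: psi_inj; rewrite linear0 linearZZ psim.
pose sI := is_submod_range f; pose I := fgsub dimd sI.
have [|f' f'E] := @fgincl_factor _ _ dimd X N _ sI f; first by move=> z; exists z.
have f'_onto : onto f'.
  move=> z; have [x2 _ x2z] := fginclP z; exists x2.
  by apply: (@fgincl_inj _ _ dimd); rewrite f'E.
have [||phi phiE] := @lin_cyclic I M (f' x) m.
- move=> z; have [x2 <-] := f'_onto z; have [a fx2] := f_y x2.
  by exists a; apply: (@fgincl_inj _ _ dimd); rewrite linearZZ !f'E.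
- move=> a ax0; apply: ann; rewrite /y -f'E -linearZZ ax0; exact: linear0.
have phi_y x2 a : f x2 = a *: y -> phi (f' x2) = a *: m.
  move=> fx2; rewrite -phiE -linearZZ; congr (phi _).
  by apply: (@fgincl_inj _ _ dimd); rewrite linearZZ !f'E.
(* If [a x + i z] is in [K], then [f (i (- z)) = a y], which [phi] takes to [a m]. Conversely,
   [f (i z) = a y] puts [a x - i z] in [K]. *)
have gKE : [set g x | x in [set x | f x = 0]] = range ((phi \o f') \o i).
  apply/seteqP; split=> [_ [x2 /= fx2 <-]|_ [z _ <-]].
    have [a [z x2E]] := dec x2; exists (- z) => //=.
    have giz : g (i z) = 0 by apply/ig; exists z.
    rewrite (phi_y _ a) ?x2E ?linearD ?linearZZ ?gx ?giz ?addr0 // !linearN.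
    by move/eqP: fx2; rewrite x2E linearD linearZZ addr_eq0 => /eqP ->.
  have [a fiz] := fi_y z; exists (a *: x - i z) => /=.
    by rewrite linearB linearZZ fiz subrr.
  have giz : g (i z) = 0 by apply/ig; exists z.
  by rewrite linearB linearZZ gx giz subr0 (phi_y _ a).
have [_ rL] := IH L M ((phi \o f') \o i) (leq_trans lt_L le_n) fL CM.
split; first by apply: ker_f; rewrite gKE.
apply/(sub_in_fgsub dimd isoF sI)/(sub_inT isoF).
apply: (sub_in_ext dimd isoF extF (P := [set z | phi z = 0]) (g := phi)).
- exact: is_submodT.
- by apply/seteqP; split=> z //= [].
- pose sI' := is_submod_range (f' \o i); pose j := fgincl dimd sI'.
  have [|h hE] := @fgincl_factor _ _ dimd L I _ sI' (f' \o i).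
    by move=> z; exists z.
  (* As a quotient of [L], the submodule [f L] is small enough for the induction hypothesis to give
     the kernel of [phi] on it. *)
  have le_I' : (d (fgsub dimd sI') <= d L)%N.
    apply: (dim_onto_le dimd (f := h)) => z; have [z' _ z'E] := fginclP z.
    by exists z'; apply: (@fgincl_inj _ _ dimd); rewrite hE.
  have fI' : filt C (fgsub dimd sI').
    apply: (sub_inE isoF rfi (i := fgincl dimd sI \o j)).
      by apply: inj_comp; apply: fgincl_inj.
    apply/seteqP; split=> [_ [z _ <-]|_ [z _ <-]].
      have [z' _ z'E] := @fginclP _ _ dimd _ _ sI' z; exists z' => //=.
      by rewrite -f'E; congr (fgincl _ _ _).
    by exists (h z) => //=; rewrite [j _]hE /= f'E.
  have [kI' _] := IH _ M (phi \o j) (leq_ltn_trans le_I' (leq_trans lt_L le_n)) fI' CM.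
  (* If [phi] kills [f x2 = a y], then [a m = 0], so [a x] comes from [L] and [f x2 = f (a x)] lies
     in [f L]. *)
  have -> : [set z | phi z = 0] = [set j z | z in [set z | (phi \o j) z = 0]].
    apply/seteqP; split=> [z /= phiz|_ [z /= phiz <-] //].
    have [x2 x2z] := f'_onto z; have [a fx2] := f_y x2.
    have am : a *: m = 0 by rewrite -(phi_y x2 a) // x2z.
    have [z' z'E] : exists z', i z' = a *: x by apply/ig; rewrite linearZZ gx am.
    have [|w wz] := @fgincl_lift _ _ dimd _ _ sI' z.
      exists z' => //=; apply: (@fgincl_inj _ _ dimd).
      by rewrite -x2z !f'E z'E linearZZ fx2.
    by exists w => //=; rewrite [j w]wz.
  by apply: sub_in_image => //; exact: fgincl_inj.
- have -> : [set phi z | z in setT] = setT.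
    apply/seteqP; split=> // m2 _; have [a ->] := genM m2.
    by exists (a *: f' x) => //; rewrite linearZZ phiE.
  by apply/(sub_inT isoF); exact: (filt_in dimd CM).
Qed.

(** Induct on the filtration of [Y], using [filt_hom_mono] for its top factor. On [K = ker (q f)]
    the map [f] restricts to [h : K -> Y']; its kernel is that of [f], and [range f] is an extension
    of [range (q f)] by [range h]. *)
Lemma filt_hom X Y (f : {linear X -> Y}) : filt C X -> filt C Y -> KI f.
Proof.
move=> fX fY; elim: fY X fX f => [Z Z0 X fX f|Y' {}Y N i q ex _ IH CN X fX f].
  split.
    have -> : [set x | f x = 0] = setT by apply/seteqP; split=> x // _; apply: Z0.
    by apply/(sub_inT isoF).
  by apply: (sub_in_zero dimd isoF extF); [exact: is_submod_range|].
have [i_inj q_onto iq] := (short_exactP i q).1 ex.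
have [kh rh] := filt_hom_mono (q \o f) fX CN.
have sK := is_submod_ker (q \o f); pose K := fgsub dimd sK.
pose j := fgincl dimd sK.
have fK : filt C K by apply/(sub_in_fgsub dimd isoF sK).
have [|h hE] := @lin_factor_inj R K Y Y' (f \o j) i i_inj.
  move=> _ [x _ <-]; have /iq[y yE] := @fginclP _ _ dimd _ _ sK x.
  by exists y.
have [khK rhK] := IH K fK h; split.
  have -> : [set x | f x = 0] = [set j x | x in [set x | h x = 0]].
    apply/seteqP; split=> [x /= fx|_ [x /= hx <-] /=].
      have [|y yx] := @fgincl_lift _ _ dimd _ _ sK x; first by rewrite /= fx linear0.
      by exists y => //=; apply: i_inj; rewrite hE /= [j y]yx fx linear0.
    by rewrite -[LHS]hE hx linear0.
  by apply: sub_in_image => //; exact: fgincl_inj.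
apply: (sub_in_ext dimd isoF extF (P := [set i y | y in range h]) (g := q)).
- exact: is_submod_range.
- apply/seteqP; split=> [_ [_ [x _ <-] <-]|_ /= [[x _ <-] qfx]].
    by split; [exists (j x); rewrite ?hE|apply/iq; exists (h x)].
  have [y yx] := @fgincl_lift _ _ dimd _ _ sK x qfx.
  by exists (h y); [exists y|rewrite hE /= [j y]yx].
- exact: sub_in_image.
- have -> // : [set q y | y in range f] = range (q \o f).
  apply/seteqP; split=> [_ [_ [x _ <-] <-]|_ [x _ <-]]; first by exists x.
  by exists (f x) => //; exists x.
Qed.

Lemma filt_ext_ker_im : ext_ker_im_closed (filt C).
Proof.
split=> //= X Y f fX fY K i i_inj ri; have [kf rf] := filt_hom f fX fY.
  exact: (sub_inE isoF kf i_inj ri).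
exact: (sub_inE isoF rf i_inj ri).
Qed.

End MonobrickClosure.

(** * Right modules over a finite-dimensional algebra *)

Section Converse.
Variables (k : fieldType) (A : falgType k).

Definition scalarc (c : k) : A^c := c%:A.

Fact scalarc_zmod_morphism : zmod_morphism scalarc.
Proof. by move=> a b; rewrite /scalarc scalerBl. Qed.

Fact scalarc_monoid_morphism : monoid_morphism scalarc.
Proof.
split=> [|a b]; first by rewrite /scalarc scale1r.
by rewrite -[RHS]/((b%:A : A) * (a%:A : A)) -scalerAl mul1r scalerA mulrC.
Qed.

HB.instance Definition _ :=
  GRing.isZmodMorphism.Build k A^c scalarc scalarc_zmod_morphism.
HB.instance Definition _ :=
  GRing.isMonoidMorphism.Build k A^c scalarc scalarc_monoid_morphism.

Lemma is_dimension_converse : exists d : fgMod A^c -> nat, is_dimension d.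
Proof.
apply: (@finite_dimension_exists A^c k scalarc (\dim {:A})).
exists (fun i => (vbasis {:A})`_i) => x.
have /coord_vbasis xE : (x : A) \in {:A}%VS by exact: memvf.
exists (\row_i coord (vbasis {:A}) i (x : A)); rewrite {1}xE.
apply: eq_bigr => i _; rewrite mxE.
by rewrite -[RHS]/(((vbasis {:A})`_i : A) * (_%:A : A)) -scalerAr mulr1.
Qed.

Lemma primitive_idem_converse (e : A) :
  primitive_idem (e : A^c) -> primitive_idem e.
Proof. by move=> [e0 ee prim]; split=> // u uu eu ue; apply: prim. Qed.

(** Seriality of [A^c] makes primitive idempotents left serial in [A^c]; seriality of [A] makes them
    right serial, as left multiples in [A] are right multiples in [A^c]. *)
Lemma nakayama_brick_cyclic (d : fgMod A^c -> nat) (M : modr A) :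
  is_dimension d -> nakayama A -> brick M -> serial_cyclic M.
Proof.
move=> dimd [serA serAc] brickM.
have [p [sum_p prim_p]] := primitive_decomposition dimd (mul1r (1 : A^c)).
have idem_p e : e \in p -> e * e = e by move=> /prim_p[].
have left_p e : e \in p -> left_serial e.
  by move=> /prim_p ep; apply: primitive_left_serial.
have right_p e : e \in p -> right_serial e.
  move=> /prim_p /primitive_idem_converse /primitive_left_serial /(_ serA) ser.
  by move=> a b ea eb; apply: ser.
have [e [x [ep ex gen]]] := brick_cyclic dimd sum_p idem_p left_p right_p brickM.
by exists e, x; split=> //; [exact: idem_p|exact: left_p].
Qed.

End Converse.

Theorem theorem6p1 (k : closedFieldType) (A : falgType k) (nakA : nakayama A) :
  (forall E : modr A -> Prop, iso_closed E ->
     (left_schur E <-> ext_ker_im_closed E)) /\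
  [/\ forall C : modr A -> Prop, monobrick C ->
        iso_closed (Filt C) /\ ext_ker_im_closed (Filt C),
      forall E : modr A -> Prop, iso_closed E -> ext_ker_im_closed E ->
        monobrick (sim E),
      forall C : modr A -> Prop, monobrick C -> sim (Filt C) = C &
      forall E : modr A -> Prop, iso_closed E -> ext_ker_im_closed E ->
        Filt (sim E) = E].
Proof.
have [d dimd] := is_dimension_converse A.
have FiltE (C : modr A -> Prop) : (forall M, C M -> ~ is_zero M) -> Filt C = filt C.
  by move=> C0; apply: funext => M; apply/propext; apply: filtP dimd _ C0 M.
have Filt_mono (C : modr A -> Prop) : monobrick C -> Filt C = filt C.
  by move=> [_ brickC _]; apply: FiltE => M /brickC[].
have Filt_sim (E : modr A -> Prop) : iso_closed E -> ext_closed E ->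
    Filt (sim E) = E.
  move=> isoE extE; rewrite FiltE; last by move=> M [].
  by apply: funext => M; apply/propext; apply: (filt_sim dimd).
have clFilt (C : modr A -> Prop) : monobrick C -> ext_ker_im_closed (Filt C).
  move=> mC; rewrite Filt_mono //; apply: (filt_ext_ker_im dimd mC) => N CN.
  by apply: (nakayama_brick_cyclic dimd nakA); have [_ brickC _] := mC; apply: brickC.
split=> [E isoE|]; last split.
- split=> [schurE|]; last exact: (ext_ker_im_left_schur dimd).
  rewrite -(Filt_sim E isoE schurE.1); apply: clFilt.
  exact: (left_schur_monobrick dimd isoE schurE).
- move=> C mC; split; last exact: clFilt.
  by rewrite Filt_mono //; exact: filt_iso.
- move=> E isoE clE; apply: (left_schur_monobrick dimd isoE).
  exact: (ext_ker_im_left_schur dimd clE).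
- move=> C mC; rewrite Filt_mono //.
  by apply: funext => M; apply/propext; apply: (sim_filt dimd).
- by move=> E isoE [extE _ _]; apply: Filt_sim.
Qed.
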